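(* Let $\Gamma$ be a finite vertex-transitive graph on $n$ vertices. Then: \begin{enumerate} \item If $\mathrm{Aut}(\Gamma)$ contains a $2$-cycle (equivalently, if $\mu(\Gamma)=2$), then $\Gamma\cong \Theta[K_m]$ or $\Gamma\cong\Theta[mK_1]$ for some vertex-transitive graph $\Theta$ on $k$ vertices and some $m\ge 2$ with $n=mk$. Conversely, for every vertex-transitive graph $\Theta$ and every $m\ge 2$, the graphs $\Theta[K_m]$ and $\Theta[mK_1]$ have motion $2$. \item If $\mathrm{Aut}(\Gamma)$ contains a $p$-cycle for some prime $p\ge 3$, then either (a) $\mu(\Gamma)=2$ (and so $\Gamma$ is as described in part 1), or (b) $\Gamma\cong\Theta[\Sigma_p]$ where $\Sigma_p$ is a circulant graph on $p$ vertices and $\Theta$ is a vertex-transitive graph; in case (b), $\mu(\Gamma)=2$ if $\Sigma_p\cong K_p$ or $\Sigma_p\cong pK_1$, and $\mu(\Gamma)=p-1$ otherwise. \item If $\mu(\Gamma)=4$, then one of the following holds: (a) $\Gamma\cong\Theta[C_5]$ for a vertex-transitive graph $\Theta$; (b) $\Gamma\cong\Theta[K_m\square K_2]$ or $\Gamma\cong\Theta[\overline{K_m\square K_2}]$ for some $m\ge 3$ and a vertex-transitive graph $\Theta$; (c) $\Gamma\cong \mathrm{Inf}(\Sigma,\mathcal P,m,\lambda,\kappa)$ for some $m\ge 2$, $\lambda,\kappa\in\mathbb Z_2$, a graph $\Sigma$ and a partition $\mathcal P$ of $V\Sigma$ into sets of size $2$ such that $\mathrm{Aut}_{\mathcal P}(\Sigma)$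 is transitive on $V\Sigma$ and it is not the case that both $\lambda\neq\kappa$ and the transposition $(\alpha\ \beta)$ is an automorphism of $\Sigma$ for some $\{\alpha,\beta\}\in\mathcal P$. Conversely, for every vertex-transitive graph $\Theta$ and every $m\ge 3$ the graphs $\Theta[C_5]$, $\Theta[K_m\square K_2]$ and $\Theta[\overline{K_m\square K_2}]$ have motion $4$; and for every vertex-transitive graph $\Sigma$ admitting an $\mathrm{Aut}(\Sigma)$-invariant partition $\mathcal P$ of $V\Sigma$ into sets of size $2$, every $m\ge 2$ and every $\lambda,\kappa\in\mathbb Z_2$ such that it is not the case that both $\lambda\ne\kappa$ and $(\alpha\ \beta)\in\mathrm{Aut}(\Sigma)$ for some $\{\alpha,\beta\}\in\mathcal P$, the graph $\mathrm{Inf}(\Sigma,\mathcal P,m,\lambda,\kappa)$ has motion $4$. \end{enumerate}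
   Context: All graphs are finite, simple and undirected. For a permutation group $G$ on a finite set $\Omega$, the support of $x\in G$ is $\mathrm{supp}(x)=\{\omega:\omega^x\ne\omega\}$ and the minimal degree of $G$ is $\mu(G)=\min\{|\mathrm{supp}(x)|: x\in G\setminus\{1\}\}$. The motion $\mu(\Gamma)$ of a graph $\Gamma$ is the minimal degree of $\mathrm{Aut}(\Gamma)$ acting on the vertex set $V\Gamma$. For graphs $\Theta,\Delta$, the lexicographic product $\Theta[\Delta]$ has vertex set $V\Delta\times V\Theta$, with $(\delta_1,\theta_1)\sim(\delta_2,\theta_2)$ iff either $\theta_1=\theta_2$ and $\delta_1\sim\delta_2$, or $\theta_1\sim\theta_2$ (so each vertex of $\Theta$ is replaced by a copy of $\Delta$). $K_m$ is the complete graph, $mK_1$ the edgeless graph on $m$ vertices, $C_5$ the $5$-cycle, $\square$ the Cartesian product of graphs, and $\overline{\Gamma}$ the complement. A circulant graph on $p$ vertices is a graph on $\mathbb Z_p$ invariant under all translations. For a graph $\Sigma$ and a partition $\mathcal P$ of $V\Sigma$ into sets of size $2$, $\mathrm{Aut}_{\mathcal P}(\Sigma)$ is the group of automorphisms $x$ of $\Sigma$ such that $\{\alpha,\beta\}\in\mathcal P\iff\{\alpha^x,\beta^x\}\in\mathcal P$. For such $\Sigma,\mathcal P$, an integer $m\ge2$ and $\lambda,\kappa\in\mathbb Z_2$, the graph $\mathrm{Inf}(\Sigma,\mathcal P,m,\lambda,\kappa)$ has vertex set $V\Sigma\times\{1,\dots,m\}$, and $(\alpha,i)\sim(\beta,j)$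 iff one of: $\{\alpha,\beta\}\notin\mathcal P$ and $\alpha\sim\beta$ in $\Sigma$; $\{\alpha,\beta\}\in\mathcal P$, $\lambda=1$ and $i=j$; $\{\alpha,\beta\}\in\mathcal P$, $\lambda=0$ and $i\ne j$; $\alpha=\beta$ (and $i\neq j$) and $\kappa=1$.
   Formalization: In the last converse of part 3 the case m=2, λ=κ with (α β)∈Aut(Σ) for some {α,β}∈P is also excluded: there (α,1) and (β,2) can be exchanged, so the motion is 2 (e.g. Σ=K_2, m=2, λ=κ=1 gives the 4-cycle). *)

(* Defs.v *)
From HB Require Import structures.
From mathcomp Require Import all_boot all_order all_algebra all_fingroup.

Set Implicit Arguments.
Unset Strict Implicit.
Unset Printing Implicit Defensive.

Record graph (V : finType) := Graph {
  edge :> rel V;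
  edge_sym : symmetric edge;
  edge_irr : irreflexive edge
}.

Definition graph_iso (V W : finType) (G : graph V) (H : graph W) : Prop :=
  exists f : V -> W, bijective f /\ forall x y, H (f x) (f y) = G x y.

Section Permutations.
Variable T : finType.
Implicit Types (x : {perm T}) (A : {set {perm T}}).

Definition supp x : {set T} := [set w | x w != w].

(* Nontrivial cycles only: a singleton [porbit x w] is disjoint from [supp x]. *)
Definition is_cycle (k : nat) x : bool :=
  [exists w, supp x == porbit x w] && (#|supp x| == k).

(* The minimal degree of the trivial group is undefined in the literature;
   here it is 0, which is never the support size of a nonidentity element
   (the default element of [arg min] is 1, used only when [A :\ 1] is empty). *)
Definition min_degree A : nat := #|supp [arg min_(x < 1%g in A :\ 1%g) #|supp x|]|.

Lemma supp1 : supp 1%g = set0.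
Proof. by apply/setP=> w; rewrite !inE perm1 eqxx. Qed.

Lemma supp_gt1 x : x != 1%g -> 1 < #|supp x|.
Proof.
move=> xn1; have [w xw] : exists w, x w != w.
  apply/existsP; rewrite -negb_forall; apply: contra xn1 => /forallP xid.
  by apply/eqP/permP=> w; rewrite perm1; exact/eqP.
have -> : 1 < #|supp x| = (#|[set w; x w]| <= #|supp x|).
  by rewrite cards2 eq_sym xw.
apply: subset_leq_card; apply/subsetP=> z; rewrite !inE.
by case/orP=> /eqP->; rewrite // (inj_eq perm_inj).
Qed.

Lemma min_degreeP A : A :\ 1%g != set0 ->
  (exists2 x, x \in A :\ 1%g & #|supp x| = min_degree A)
  /\ (forall x, x \in A :\ 1%g -> min_degree A <= #|supp x|).
Proof.
case/set0Pn=> x0 Ax0.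
have [y Ay minA] := @arg_minnP _ x0 (fun x => x \in A :\ 1%g) (fun x => #|supp x|) Ax0.
rewrite /min_degree /arg_min /extremum; case: pickP => [z /andP[Az /forallP minz]|].
  split; first by exists z.
  by move=> x Ax; have /implyP := minz x; apply.
move/(_ y) => /=; rewrite Ay /= => /negbT/forallPn[x].
by rewrite negb_imply => /andP[Ax]; rewrite minA.
Qed.

Lemma min_degree1 : min_degree 1%g = 0.
Proof.
rewrite /min_degree /arg_min /extremum; case: pickP => [z|_] /=.
  by rewrite setDv inE.
by rewrite supp1 cards0.
Qed.

End Permutations.

Section Automorphisms.
Variables (V : finType) (G : graph V).

Definition gaut : {set {perm V}} :=
  [set x : {perm V} | [forall a, forall b, G (x a) (x b) == G a b]].

Lemma gautP (x : {perm V}) : reflect (forall a b, G (x a) (x b) = G a b) (x \in gaut).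
Proof.
rewrite inE; apply: (iffP forallP) => [H a b | H a]; last first.
  by apply/forallP=> b; apply/eqP.
by move: (H a) => /forallP/(_ b)/eqP.
Qed.

Lemma gaut_group_set : group_set gaut.
Proof.
apply/group_setP; split; first by apply/gautP=> a b; rewrite !perm1.
move=> x y /gautP Hx /gautP Hy; apply/gautP=> a b.
by rewrite !permM Hy Hx.
Qed.

Canonical gaut_group := Group gaut_group_set.

(* [transitive _, on S | _] forces S to be nonempty. *)
Definition vertex_transitive : bool := [transitive gaut, on [set: V] | 'P].

Definition motion : nat := min_degree gaut.

End Automorphisms.

Section Constructions.

Fact complete_sym m : symmetric (fun i j : 'I_m => i != j).
Proof. by move=> i j; rewrite eq_sym. Qed.
Fact complete_irr m : irreflexive (fun i j : 'I_m => i != j).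
Proof. by move=> i; rewrite eqxx. Qed.
Definition complete m : graph 'I_m := Graph (@complete_sym m) (@complete_irr m).

Fact edgeless_sym m : symmetric (fun _ _ : 'I_m => false).
Proof. by []. Qed.
Fact edgeless_irr m : irreflexive (fun _ _ : 'I_m => false).
Proof. by []. Qed.
Definition edgeless m : graph 'I_m := Graph (@edgeless_sym m) (@edgeless_irr m).

Definition C5_rel : rel 'I_5 :=
  fun i j => (i.+1 %% 5 == j :> nat) || (j.+1 %% 5 == i :> nat).
Fact C5_sym : symmetric C5_rel.
Proof. by move=> i j; rewrite /C5_rel orbC. Qed.
Fact C5_irr : irreflexive C5_rel.
Proof. by case=> [[|[|[|[|[|]]]]]]. Qed.
Definition C5 : graph 'I_5 := Graph C5_sym C5_irr.

Variables V W : finType.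

Definition complement_rel (G : graph V) : rel V := fun x y => (x != y) && ~~ G x y.
Fact complement_sym G : symmetric (complement_rel G).
Proof. by move=> x y; rewrite /complement_rel eq_sym edge_sym. Qed.
Fact complement_irr G : irreflexive (complement_rel G).
Proof. by move=> x; rewrite /complement_rel eqxx. Qed.
Definition complement G : graph V := Graph (complement_sym G) (complement_irr G).

Definition cartprod_rel (G : graph V) (H : graph W) : rel (V * W) :=
  fun u v => ((u.1 == v.1) && H u.2 v.2) || ((u.2 == v.2) && G u.1 v.1).
Fact cartprod_sym G H : symmetric (cartprod_rel G H).
Proof.
move=> u v; rewrite /cartprod_rel (eq_sym u.1) (eq_sym u.2).
by rewrite (edge_sym G) (edge_sym H).
Qed.
Fact cartprod_irr G H : irreflexive (cartprod_rel G H).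
Proof. by move=> u; rewrite /cartprod_rel !edge_irr !andbF. Qed.
Definition cartprod G H : graph (V * W)%type :=
  Graph (cartprod_sym G H) (cartprod_irr G H).

(* [lexprod Theta Delta] is Theta[Delta]: each vertex of Theta is replaced by a
   copy of Delta, and the Delta-coordinate comes first. *)
Definition lexprod_rel (Theta : graph W) (Delta : graph V) : rel (V * W) :=
  fun u v => ((u.2 == v.2) && Delta u.1 v.1) || Theta u.2 v.2.
Fact lexprod_sym Theta Delta : symmetric (lexprod_rel Theta Delta).
Proof.
move=> u v; rewrite /lexprod_rel (eq_sym u.2).
by rewrite (edge_sym Theta) (edge_sym Delta).
Qed.
Fact lexprod_irr Theta Delta : irreflexive (lexprod_rel Theta Delta).
Proof. by move=> u; rewrite /lexprod_rel !edge_irr andbF. Qed.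
Definition lexprod Theta Delta : graph (V * W)%type :=
  Graph (lexprod_sym Theta Delta) (lexprod_irr Theta Delta).

End Constructions.

(* 'Z_p really is the ring of integers mod p only for 1 < p. *)
Definition circulant (p : nat) (S : graph 'Z_p) : Prop :=
  forall c x y : 'Z_p, S (x + c)%R (y + c)%R = S x y.

Record pair_partition (V : finType) := PairPartition {
  blocks :> {set {set V}};
  blocks_partition : partition blocks [set: V];
  blocks_card2 : forall B, B \in blocks -> #|B| = 2
}.

Section Inflation.
Variables (V : finType) (S : graph V) (P : pair_partition V).

Definition gaut_part : {set {perm V}} :=
  [set x in gaut S | [forall a, forall b,
     ([set a; b] \in blocks P) == ([set x a; x b] \in blocks P)]].

Definition invariant_partition : Prop :=
  forall (x : {perm V}) (B : {set V}),
    x \in gaut S -> B \in blocks P -> x @: B \in blocks P.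

Definition has_block_transposition : Prop :=
  exists a b : V, [set a; b] \in blocks P /\ tperm a b \in gaut S.

(* The parameters lambda, kappa in Z_2 are booleans: true is 1, false is 0. *)
Definition Inf_rel (m : nat) (lambda kappa : bool) : rel (V * 'I_m) :=
  fun u v =>
    [|| ([set u.1; v.1] \notin blocks P) && S u.1 v.1,
        [&& [set u.1; v.1] \in blocks P, lambda == true & u.2 == v.2],
        [&& [set u.1; v.1] \in blocks P, lambda == false & u.2 != v.2] |
        [&& u.1 == v.1, u.2 != v.2 & kappa == true]].

Fact Inf_sym m lambda kappa : symmetric (@Inf_rel m lambda kappa).
Proof.
move=> u v; rewrite /Inf_rel (setUC [set u.1]) edge_sym.
by rewrite (eq_sym u.1) (eq_sym u.2).
Qed.
Fact Inf_irr m lambda kappa : irreflexive (@Inf_rel m lambda kappa).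
Proof.
move=> u; rewrite /Inf_rel edge_irr !eqxx /= !andbF /= setUid.
case: (boolP ([set u.1] \in _)) => // /blocks_card2.
by rewrite cards1.
Qed.
Definition Inf m lambda kappa : graph (V * 'I_m)%type :=
  Graph (@Inf_sym m lambda kappa) (@Inf_irr m lambda kappa).

End Inflation.

Definition lex_K_form (n : nat) (V : finType) (G : graph V) : Prop :=
  exists (k m : nat) (W : finType) (Theta : graph W),
    [/\ vertex_transitive Theta, #|W| = k, 2 <= m, n = m * k
      & graph_iso G (lexprod Theta (complete m))
        \/ graph_iso G (lexprod Theta (edgeless m))].

(* When m = 2 and lambda = kappa, the subgraph of Inf on {alpha, beta} x {1, 2}
   is C_4 or 2K_2. If also (alpha beta) is an automorphism of Sigma, exchanging
   (alpha, 1) and (beta, 2) is an automorphism of Inf, which then has motion 2.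
   K_2 is the smallest instance. *)
Section K2Inflation.

Fact K2_blocks_partition : partition [set [set: 'I_2]] [set: 'I_2].
Proof.
rewrite /partition cover1 eqxx trivIset1 inE /= eq_sym.
by apply/set0Pn; exists ord0; rewrite inE.
Qed.
Fact K2_blocks_card2 (B : {set 'I_2}) : B \in [set [set: 'I_2]] -> #|B| = 2.
Proof. by rewrite inE => /eqP->; rewrite cardsT card_ord. Qed.
Definition K2_pair := PairPartition K2_blocks_partition K2_blocks_card2.

Lemma K2_vertex_transitive : vertex_transitive (complete 2).
Proof.
apply/imsetP; exists ord0; rewrite ?inE //.
apply/esym/setP=> i; rewrite inE; apply/orbitP; exists (tperm ord0 i).
  by apply/gautP=> a b /=; rewrite (inj_eq perm_inj).
by rewrite /= apermE tpermL.
Qed.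

Lemma K2_invariant : invariant_partition (complete 2) K2_pair.
Proof.
move=> x B _; rewrite !inE => /eqP->; rewrite eqEcard subsetT /=.
by rewrite card_imset //; exact: perm_inj.
Qed.

Lemma motion_Inf_K2 lambda : motion (Inf (complete 2) K2_pair 2 lambda lambda) = 2.
Proof.
rewrite /motion; set A := gaut _; pose a : 'I_2 * 'I_2 := (ord0, ord0).
pose b : 'I_2 * 'I_2 := (ord_max, ord_max); pose t := tperm a b.
have block u v : [set u; v] \in blocks K2_pair = (u != v).
  rewrite inE eqEcard subsetT cardsT card_ord cards2 /=.
  by case: (u != v).
have ba : (b == a) = false by vm_compute.
have At : t \in A.
  apply/gautP=> -[i j] [k l]; rewrite /= /Inf_rel !block.
  rewrite /t !permE /= /a /b !xpair_eqE.
  by move: i j k l {A} lambda => [[|[|//]] ?] [[|[|//]] ?] [[|[|//]] ?] [[|[|//]] ?] []; vm_compute.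
have tn1 : t != 1%g.
  by apply/eqP=> /permP/(_ a)/eqP; rewrite tpermL perm1 ba.
have At1 : t \in A :\ 1%g by rewrite in_setD1 tn1.
have [|[x Ax1 cx] minA] := @min_degreeP _ A; first by apply/set0Pn; exists t.
apply/eqP; rewrite eqn_leq; apply/andP; split.
  apply: leq_trans (minA t At1) _.
  have -> : supp t = [set a; b]; last by rewrite cards2 eq_sym ba.
  apply/setP=> w; rewrite !inE; case: tpermP => [->|->|/eqP/negPf-> /eqP/negPf->].
  - by rewrite eqxx.
  - by rewrite eqxx orbT.
  - by rewrite eqxx.
by rewrite -cx supp_gt1 //; case/setD1P: Ax1.
Qed.

End K2Inflation.

(* Main.v *)
Require Import Defs.
From HB Require Import structures.
From mathcomp Require Import all_boot all_order all_algebra all_fingroup.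
From mathcomp Require Import all_field zify.

Set Implicit Arguments.
Unset Strict Implicit.
Unset Printing Implicit Defensive.

(* A nontrivial automorphism moving at most three points forces a pair of twins
   (vertices whose transposition is an automorphism), so motion 2 means twins and
   the twin classes give Theta[K_m] or Theta[m K_1].

   The support of a p-cycle is a module (every vertex outside is adjacent to all
   or none of it). In a twin-free graph two such supports are equal or disjoint,
   so they form an invariant partition, whence G = Theta[S] with S a circulant.
   Burnside's theorem on groups of prime degree, proved for connection sets by
   Mueller's polynomial argument, shows that nontrivial automorphisms of S fix at
   most one point.

   In a twin-free graph, if (a b)(c d) is an automorphism, then {c, d} is exactly
   the set of vertices distinguishing a from b. Two such involutions with
   overlapping supports either generate a dihedral group on a pentagon, which
   yields a 5-cycle, or are (a b)(c d) and (b e)(d g). In the absence of pentagons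
   the pairs {a, b} therefore span the classes of an equivalence relation, the
   classes are matched in pairs, and the graph is the inflation of its quotient. *)

(** * Twins and small supports *)

(** Burnside's theorem enters through a dichotomy. A group of prime degree is 2-transitive or
    affine, and a graph with a 2-transitive group is complete or edgeless. A circulant that is
    neither therefore has only affine automorphisms, which is what excludes any support smaller than
    p - 1.

    For motion 4, matching the classes in pairs is not yet an inflation: the edges between two
    matched classes must form a perfect matching or its complement. Each vertex must therefore
    single out one vertex of the matched class. Inside a class, adjacency must also be constant. The
    first comes from the pairs {c, d} that accompany a given vertex, the second from the fact that
    no vertex of a class distinguishes two others. Transitivity makes the resulting constants
    [lambda] and [kappa] the same everywhere. *)

Section Twins.
Variables (V : finType) (G : graph V).
Implicit Types (a b u v : V) (x g : {perm V}).

(** Whether a and b are themselves adjacent is left open, so that one relation serves both for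
    Theta[K_m] and for Theta[mK_1]. *)
Definition twins a b : bool :=
  [forall v, (v != a) ==> (v != b) ==> (G v a == G v b)].

Lemma twinsP a b :
  reflect (forall v, v != a -> v != b -> G v a = G v b) (twins a b).
Proof.
apply: (iffP forallP) => [H v va vb | H v].
  by move: (H v); rewrite va vb => /eqP.
by apply/implyP=> va; apply/implyP=> vb; apply/eqP; exact: H.
Qed.

Definition twin_free : Prop := forall a b, twins a b -> a = b.

Lemma twins_refl : reflexive twins.
Proof. by move=> a; apply/twinsP. Qed.

Lemma twins_sym : symmetric twins.
Proof. by move=> a b; apply/twinsP/twinsP=> H v va vb; rewrite H. Qed.

(** Only the middle vertex b needs care. There G b a = G a c = G c b, by comparing b with c as seen
    from a, and a with b as seen from c. *)
Lemma twins_trans : transitive twins.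
Proof.
move=> b a c /twinsP Hab /twinsP Hbc; apply/twinsP=> v va vc.
have [vb|vb] := eqVneq v b; last by rewrite Hab ?Hbc.
subst v; have [->//|ac] := eqVneq a c.
rewrite edge_sym Hbc // 1?eq_sym //.
by rewrite edge_sym Hab 1?eq_sym // edge_sym.
Qed.

Lemma twins_gaut g a b : g \in gaut G -> twins (g a) (g b) = twins a b.
Proof.
move=> /gautP gG; apply/twinsP/twinsP=> H v va vb.
  by rewrite -gG -[RHS]gG H // (inj_eq perm_inj).
have: g^-1%g v != a /\ g^-1%g v != b.
  by split; [move: va | move: vb]; apply: contraNneq => <-; rewrite permKV.
by case=> va' vb'; move: (H _ va' vb'); rewrite -gG -[in RHS]gG permKV.
Qed.

Lemma tperm_gaut a b : (tperm a b \in gaut G) = twins a b.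
Proof.
apply/gautP/twinsP=> [H v va vb | H u v].
  by rewrite -(H v a) tpermL tpermD // eq_sym.
have H' w : w != a -> w != b -> G a w = G b w.
  by move=> wa wb; rewrite edge_sym H // edge_sym.
case: (tpermP a b u) => [->|->|/eqP ua /eqP ub];
case: (tpermP a b v) => [->|->|/eqP va /eqP vb] //.
- by rewrite !edge_irr.
- exact: edge_sym.
- by rewrite H'.
- exact: edge_sym.
- by rewrite !edge_irr.
- by rewrite H'.
- by rewrite H.
- by rewrite H.
Qed.

Lemma supp_tperm a b : a != b -> supp (tperm a b) = [set a; b].
Proof.
move=> ab; apply/setP=> w; rewrite !inE.
case: tpermP => [->|->|/eqP/negPf-> /eqP/negPf->]; rewrite ?eqxx //.
  by rewrite eq_sym ab.
by rewrite orbT.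
Qed.

Lemma supp_perm x a : (x a \in supp x) = (a \in supp x).
Proof. by rewrite !inE (inj_eq perm_inj). Qed.

(** A vertex v fixed by x sees a and x a alike. A moved v different from both leaves x no choice but
    to rotate a, x a, v, and then x carries the pair {v, x a} to {a, v}. *)
Lemma small_supp_twins x a :
  x \in gaut G -> x a != a -> #|supp x| < 4 -> twins a (x a).
Proof.
move=> /gautP xG xa sx; apply/twinsP=> v va vxa.
have [xv|xv] := eqVneq (x v) v; first by rewrite -(xG v a) xv.
have sE : supp x = [set a; x a; v].
  apply/esym/eqP; rewrite eqEcard; apply/andP; split; last first.
    by rewrite -setUA cardsU1 cards2 !inE eq_sym (negPf xa) eq_sym (negPf va)
       eq_sym vxa.
  apply/subsetP=> w; rewrite !inE => /orP[/orP[]|] /eqP -> //.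
  by rewrite (inj_eq perm_inj).
have inS w : x w != w -> [|| x w == a, x w == x a | x w == v].
  by move=> xw; have: x w \in supp x; [rewrite supp_perm inE | rewrite sE !inE -orbA].
have := inS v xv; rewrite (negPf xv) orbF (inj_eq perm_inj) (negPf va) orbF => /eqP xva.
have : x (x a) != x a by rewrite (inj_eq perm_inj).
move/inS; rewrite !(inj_eq perm_inj) (negPf xa) /= => /orP[/eqP xxa|/eqP xxa].
  by case/eqP: vxa; apply: (@perm_inj _ x); rewrite xva.
by rewrite -[RHS]xG xva xxa edge_sym.
Qed.

Lemma motionP k :
    (exists2 x, x \in gaut G & x != 1%g /\ #|supp x| = k) ->
    (forall x, x \in gaut G -> x != 1%g -> k <= #|supp x|) ->
  motion G = k.
Proof.
move=> [x xG [x1 xk]] minx; have xA : x \in gaut G :\ 1%g by rewrite in_setD1 x1.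
have [|[y /setD1P[y1 yG] yE] miny] := @min_degreeP _ (gaut G).
  by apply/set0Pn; exists x.
rewrite /motion; apply/eqP; rewrite eqn_leq; apply/andP.
by split; [rewrite -xk miny | rewrite -yE minx].
Qed.

Lemma motion_exists : motion G != 0 ->
  exists2 x, x \in gaut G & x != 1%g /\ #|supp x| = motion G.
Proof.
have [/eqP|A0 _] := altP (@eqP _ (gaut G :\ 1%g) set0).
  (* A trivial automorphism group has [min_degree] 0 by convention, against the hypothesis. *)
  rewrite setD_eq0 => /subsetP sA1; case/eqP.
  suff -> : motion G = min_degree (1%g : {set {perm V}}) by exact: min_degree1.
  congr min_degree; apply/eqP; rewrite eqEsubset; apply/andP; split; apply/subsetP=> x.
    exact: sA1.
  by rewrite inE => /eqP->; exact: group1.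
by have [[x /setD1P[x1 xG] xE] _] := min_degreeP A0; exists x.
Qed.

Lemma twins_motion a b : a != b -> twins a b -> motion G = 2.
Proof.
move=> ab tab; apply: motionP => [|x _ x1]; last exact: supp_gt1.
exists (tperm a b); first by rewrite tperm_gaut.
split; last by rewrite supp_tperm // cards2 ab.
by apply/eqP=> /permP/(_ a); rewrite tpermL perm1 => /eqP; rewrite eq_sym (negPf ab).
Qed.

Lemma moved_point x : x != 1%g -> exists a, x a != a.
Proof.
move=> x1; have /card_gt0P[a] := ltnW (supp_gt1 x1).
by rewrite inE; exists a.
Qed.

Lemma motion2_twins : motion G = 2 -> exists a b, a != b /\ twins a b.
Proof.
move=> m2; have [|x xG [x1 sx]] := motion_exists; first by rewrite m2.
have [a xa] := moved_point x1; exists a, (x a); rewrite eq_sym; split=> //.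
by apply: small_supp_twins; rewrite // sx m2.
Qed.

Lemma motion_neq2 : motion G <> 2 -> twin_free.
Proof.
move=> m2 a b tab; apply/eqP; case: eqVneq => // ab.
by case: m2; exact: twins_motion tab.
Qed.

Lemma twin_free_supp x : twin_free -> x \in gaut G -> x != 1%g -> 4 <= #|supp x|.
Proof.
move=> tf xG x1; rewrite leqNgt; apply/negP=> sx; have [a xa] := moved_point x1.
by case/eqP: (xa); apply/esym/tf; exact: small_supp_twins.
Qed.

Lemma motion4_twin_free : motion G = 4 -> twin_free.
Proof. by move=> m4; apply: motion_neq2; rewrite m4. Qed.

Lemma is_cycle2 x : is_cycle 2 x -> exists a b, a != b /\ x = tperm a b.
Proof.
case/andP=> _ /cards2P[a [b [ab sE]]]; exists a, b; split=> //.
have xa : x a = b.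
  have xaa : x a != a by have: a \in supp x; [rewrite sE !inE eqxx | rewrite inE].
  have: x a \in supp x by rewrite supp_perm sE !inE eqxx.
  by rewrite sE !inE (negPf xaa) => /eqP.
have xb : x b = a.
  have xbb : x b != b.
    by have: b \in supp x; [rewrite sE !inE eqxx orbT | rewrite inE].
  have: x b \in supp x by rewrite supp_perm sE !inE eqxx orbT.
  by rewrite sE !inE (negPf xbb) orbF => /eqP.
apply/permP=> v; case: tpermP => [->|->|/eqP va /eqP vb] //.
have: v \notin supp x by rewrite sE !inE negb_or va vb.
by rewrite inE negbK => /eqP.
Qed.

Lemma tperm_is_cycle2 a b : a != b -> is_cycle 2 (tperm a b).
Proof.
move=> ab; rewrite /is_cycle supp_tperm // cards2 ab andbT; apply/existsP; exists a.
rewrite eqEsubset; apply/andP; split; apply/subsetP=> v; rewrite ?inE.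
  case/orP=> /eqP ->; first exact: porbit_id.
  by apply/porbitP; exists 1; rewrite expg1 tpermL.
case/porbitP=> i ->; elim: i => [|i IHi]; first by rewrite expg0 perm1 eqxx.
rewrite expgSr permM; case/orP: IHi => /eqP->; rewrite ?tpermL ?tpermR eqxx ?orbT //.
Qed.

Lemma motion2_is_cycle :
  (exists2 x, x \in gaut G & is_cycle 2 x) <-> motion G = 2.
Proof.
split=> [[x xG /is_cycle2[a [b [ab xE]]]] | /motion2_twins[a [b [ab tab]]]].
  by apply: (twins_motion ab); rewrite -tperm_gaut -xE.
by exists (tperm a b); [rewrite tperm_gaut | exact: tperm_is_cycle2].
Qed.

Lemma gaut_trans : vertex_transitive G ->
  forall a b, exists2 g, g \in gaut G & g a = b.
Proof.
move=> tG a b; have := in_setT b; rewrite -(atransP tG a (in_setT a)).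
by case/orbitP=> g gG /= <-; exists g.
Qed.

Lemma transitive_perm (A : {set {perm V}}) (v0 : V) :
  (forall a, exists2 g, g \in A & g v0 = a) -> [transitive A, on [set: V] | 'P].
Proof.
move=> tA; apply/imsetP; exists v0; rewrite ?inE //; apply/esym/setP=> a.
rewrite inE; have [g gA <-] := tA a.
by apply/orbitP; exists g.
Qed.

End Twins.

Section Isomorphism.
Variables (V W : finType) (G : graph V) (H : graph W).

Lemma graph_iso_inv (f : W -> V) : bijective f ->
  (forall u v, G (f u) (f v) = H u v) -> graph_iso G H.
Proof.
move=> [g fK gK] fE; exists g; split; first by exists f.
by move=> x y; rewrite -fE !gK.
Qed.

Lemma graph_iso_perm (f : V -> W) (x : {perm V}) : bijective f ->
    (forall u v, H (f u) (f v) = G u v) -> x \in gaut G ->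
  exists y : {perm W}, [/\ y \in gaut H, forall v, y (f v) = f (x v)
                         & #|supp y| = #|supp x|].
Proof.
move=> bf fE /gautP xG; have [g fK gK] := bf.
have yI : injective (fun w => f (x (g w))).
  by move=> w w' /(bij_inj bf)/perm_inj/(bij_inj (Bijective gK fK)).
exists (perm yI); split.
- by apply/gautP=> a b; rewrite !permE fE xG -fE !gK.
- by move=> v; rewrite permE fK.
suff -> : supp (perm yI) = f @: supp x by rewrite card_imset //; exact: bij_inj.
apply/setP=> w; rewrite -{1}(gK w) inE permE fK (inj_eq (bij_inj bf)).
apply/idP/imsetP => [xw|[v]]; first by exists (g w); rewrite ?gK ?inE.
by rewrite inE => xv ->; rewrite fK.
Qed.

End Isomorphism.

Lemma graph_iso_sym (V W : finType) (G : graph V) (H : graph W) :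
  graph_iso G H -> graph_iso H G.
Proof. by case=> f [bf fE]; apply: graph_iso_inv bf _. Qed.

Lemma motion_iso_le (V W : finType) (G : graph V) (H : graph W) :
  graph_iso G H -> motion G != 0 -> motion H = motion G.
Proof.
move=> GH m0; have [x xG [x1 sx]] := motion_exists m0.
apply: motionP.
  have [f [bf fE]] := GH; have [y [yH yf sy]] := graph_iso_perm bf fE xG.
  exists y => //; split; last by rewrite sy.
  by apply: contraTneq (supp_gt1 x1) => y1; rewrite -sy y1 supp1 cards0.
move=> y yH y1; have [f [bf fE]] := graph_iso_sym GH.
have [z [zG zf sz]] := graph_iso_perm bf fE yH; rewrite -sz.
have z1 : z \in gaut G :\ 1%g.
  rewrite in_setD1 zG andbT.
  by apply: contraTneq (supp_gt1 y1) => z1; rewrite -sz z1 supp1 cards0.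
by have [|_ ->//] := @min_degreeP _ (gaut G); apply/set0Pn; exists z.
Qed.

Lemma motion_iso (V W : finType) (G : graph V) (H : graph W) :
  graph_iso G H -> motion G = motion H.
Proof.
move=> GH; have [mG|mG] := eqVneq (motion G) 0; last by rewrite (motion_iso_le GH).
have [mH|mH] := eqVneq (motion H) 0; first by rewrite mG mH.
by rewrite (motion_iso_le (graph_iso_sym GH)).
Qed.

(** * Difference-preserving permutations of a prime field *)

Section PrimeField.
Import GRing.Theory.
Local Open Scope ring_scope.
Variables (p : nat) (p_prime : prime p).

Lemma Fp_poly_eq0 (P : {poly 'F_p}) :
  (size P <= p)%N -> (forall i, P.[i] = 0) -> P = 0.
Proof.
move=> sP P0; apply/eqP; apply/negPn/negP=> /max_poly_roots/(_ _ (enum_uniq 'F_p)).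
rewrite -cardE card_Fp // ltnNge sP => /(_ _)/negP[] //.
by apply/allP=> i _; apply/rootP.
Qed.

(** By Fermat's little theorem, 1 - (X - i)^(p-1) is the indicator of i. *)
Lemma Fp_interpolation (f : 'F_p -> 'F_p) :
  exists2 P : {poly 'F_p}, (size P <= p)%N & forall i, P.[i] = f i.
Proof.
exists (\sum_i (f i) *: (1 - ('X - i%:P) ^+ p.-1)).
  apply: leq_trans (size_sum _ _ _) _; apply/bigmax_leqP=> i _.
  apply: leq_trans (size_scale_leq _ _) _; apply: leq_trans (size_polyD _ _) _.
  rewrite size_polyN size_exp_XsubC size_poly1 prednK ?prime_gt0 //.
  by rewrite geq_max prime_gt0 /=.
move=> j; rewrite horner_sum (bigD1 j) //= big1 ?addr0 => [|i ij].
  rewrite !hornerE subrr expr0n -subn1 subn_eq0 leqNgt prime_gt1 //.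
  by rewrite subr0 mulr1.
rewrite !hornerE; suff -> : (j - i) ^+ p.-1 = 1 by rewrite subrr mulr0.
have ji : j - i != 0 by rewrite subr_eq0 eq_sym.
apply: (mulfI ji); rewrite -exprS prednK ?prime_gt0 // mulr1.
by have := expf_card (j - i); rewrite card_Fp.
Qed.

Lemma Fp_natr_eq0 n : (n%:R == 0 :> 'F_p) = (p %| n)%N.
Proof. by rewrite (dvdn_pcharf (pchar_Fp p_prime)). Qed.

Lemma Fp_bin_neq0 n k : (k <= n < p)%N -> 'C(n, k)%:R != 0 :> 'F_p.
Proof.
case/andP=> kn np; rewrite Fp_natr_eq0; apply/negP=> pC.
have : (p %| n`!)%N by rewrite -(bin_fact kn) dvdn_mulr.
elim: n np {kn pC} => [|n IHn] np; first by rewrite fact0 Euclid_dvd1.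
rewrite factS Euclid_dvdM // => /orP[/dvdn_leq|]; first by lia.
by apply: IHn; exact: ltnW.
Qed.

(** Let h have the elements of U other than u0 as its roots. If all these power sums vanished, so
    would the sum of u h(u) over U, which is u0 h(u0), a nonzero value. The factor u moves the
    exponents to the range from 1 to |U|. *)
Lemma power_sum_neq0 (U : {set 'F_p}) : 0 \notin U -> U != set0 ->
  exists2 k, (0 < k <= #|U|)%N & \sum_(u in U) u ^+ k != 0.
Proof.
move=> U0 /set0Pn[u0 Uu0].
pose h : {poly 'F_p} := \prod_(u in U :\ u0) ('X - u%:P).
have sh : size h = #|U|.
  by rewrite /h -big_enum size_prod_XsubC -cardE (cardsD1 u0 U) Uu0.
suff : [exists k : 'I_#|U|, \sum_(u in U) u ^+ k.+1 != 0].
  by case/existsP=> k pk; exists k.+1 => //=; exact: ltn_ord.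
apply: contraT; rewrite negb_exists => /forallP pk0.
have : \sum_(u in U) u * h.[u] = 0.
  under eq_bigr do rewrite horner_coef mulr_sumr sh.
  rewrite exchange_big big1 //= => k _.
  under eq_bigr do rewrite mulrCA -exprS.
  by rewrite -mulr_sumr; move: (pk0 k); rewrite negbK => /eqP->; rewrite mulr0.
rewrite (bigD1 u0) //= big1 => [|u /andP[uU uu0]]; last first.
  rewrite /h horner_prod (bigD1 u) /= ?in_setD1 ?uu0 // !hornerE subrr.
  by rewrite /= mulr0 mul0r.
have u0n0 : u0 != 0 by apply: contraNneq U0 => <-.
move/eqP; rewrite addr0 mulf_eq0 (negPf u0n0) /=.
rewrite /h horner_prod prodf_seq_eq0 => /hasP[u _ /andP[]].
by rewrite !inE !hornerE subr_eq0 eq_sym => /andP[/negPf->].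
Qed.

Lemma power_sum_min (U : {set 'F_p}) : 0 \notin U -> U != set0 ->
  exists r, [/\ (0 < r <= #|U|)%N, \sum_(u in U) u ^+ r != 0
     & forall k, (0 < k < r)%N -> \sum_(u in U) u ^+ k = 0].
Proof.
move=> U0 Un0; have [k0 /andP[k0_gt0 k0U] pk0] := power_sum_neq0 U0 Un0.
pose P k := (0 < k)%N && (\sum_(u in U) u ^+ k != 0).
have exP : exists k, P k by exists k0; rewrite /P k0_gt0.
have [r /andP[r_gt0 pr] minr] := ex_minnP exP; exists r; split=> //.
  by rewrite r_gt0 (leq_trans _ k0U) // minr // /P k0_gt0.
move=> k /andP[k_gt0 kr]; apply/eqP; apply: contraTT kr => pk.
by rewrite -leqNgt minr // /P k_gt0.
Qed.

(* Only the terms [q_N X^N] and [q_(N-r) X^(N-r)] contribute, because the power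
   sums of [U] of orders strictly between 0 and [r] vanish. *)
Lemma coef_sum_shift (U : {set 'F_p}) (Q : {poly 'F_p}) (r : nat) :
    (0 < r < size Q)%N ->
    (forall k, (0 < k < r)%N -> \sum_(u in U) u ^+ k = 0) ->
  (\sum_(u in U) (Q \Po ('X + u%:P)))`_((size Q).-1 - r) =
    Q`_((size Q).-1 - r) *+ #|U|
    + lead_coef Q * (\sum_(u in U) u ^+ r) *+ 'C((size Q).-1, r).
Proof.
move=> /andP[r_gt0 rQ] pk0; set N := (size Q).-1.
have NE : size Q = N.+1 by rewrite /N prednK // (leq_ltn_trans _ rQ).
have rN : (r <= N)%N by rewrite -ltnS -NE.
have coefX j (u : 'F_p) :
    (('X + u%:P) ^+ j)`_(N - r) = u ^+ (j - (N - r)) *+ 'C(j, N - r).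
  rewrite addrC exprDn coef_sum.
  under eq_bigr => i _.
    rewrite -rmorphXn /= coefMn coefCM coefXn.
    over.
  have [jN|jN] := ltnP j (N - r).
    rewrite bin_small // mulr0n big1 // => i _.
    by rewrite eq_sym ltn_eqF ?mulr0 ?mul0rn // (leq_trans _ jN) // ltnS -ltnS.
  rewrite (bigD1 (Ordinal (leq_ltn_trans jN (ltnSn j)))) //= eqxx mulr1 big1 ?addr0 //.
  move=> i ij; rewrite eq_sym (negPf (_ : nat_of_ord i != _)) ?mulr0 ?mul0rn //.
rewrite coef_sum; under eq_bigr do rewrite coef_comp_poly NE.
rewrite exchange_big /=.
under eq_bigr => j _.
  under eq_bigr do rewrite coefX.
  rewrite -mulr_sumr sumrMnl.
  over.
rewrite big_ord_recr /= subKn // bin_sub //.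
rewrite lead_coefE -/N mulrnAr; congr (_ + _).
have [Nr_lt|] := ltnP (N - r) N; last by lia.
rewrite (bigD1 (Ordinal Nr_lt)) //= subnn binn mulr1n.
under eq_bigr do rewrite expr0.
rewrite sumr_const mulrnAr mulr1 big1 ?addr0 // => j jN.
have [jNr|jNr] := ltnP j (N - r); first by rewrite bin_small // mulr0n mulr0.
rewrite pk0 ?mul0rn ?mulr0 //.
have jne : nat_of_ord j != (N - r)%N by [].
have := ltn_ord j; lia.
Qed.

(* Burnside's theorem for prime degree, in P. Mueller's form: writing [pi] as a
   polynomial [P] of degree [n >= 2] and [U] for the connection set, the power
   sums over [U] of [P(X + u)^w] and [(P + u)^w] agree for all [w]; the choice
   of [w] below makes their coefficients at [X^(nw - r)] differ. *)
Lemma difference_preserving_affine (U : {set 'F_p}) (pi : {perm 'F_p}) :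
    0 \notin U -> U != set0 -> (#|U|.*2 < p)%N ->
    (forall u, (- u \in U) = (u \in U)) ->
    (forall i j, (pi j - pi i \in U) = (j - i \in U)) ->
  exists a b, forall i, pi i = a * i + b.
Proof.
move=> U0 Un0 U2 UN piU; have [P sP PE] := Fp_interpolation pi.
have [sP2|sP2] := leqP (size P) 2.
  exists P`_1, P`_0 => i; rewrite -PE (horner_coef_wide _ sP2).
  by rewrite !big_ord_recr big_ord0 /= expr0 expr1 mulr1 add0r addrC.
have [r [/andP[r_gt0 rU] pr pk0]] := power_sum_min U0 Un0.
(* As U = -U, twice the first power sum is 0, and 2 is invertible because 0 < 2|U| < p. *)
have r1 : r != 1%N.
  apply: contraNneq pr => ->.
  have : \sum_(u in U) u ^+ 1 *+ 2 = 0.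
    rewrite sumrMnl mulr2n {1}(reindex_inj oppr_inj) /=.
    under eq_bigl do rewrite UN.
    by rewrite -big_split big1 //= => u _; rewrite !expr1 addNr.
  rewrite sumrMnl => /eqP; rewrite -mulr_natl mulf_eq0 Fp_natr_eq0 => /orP[|//].
  by move/dvdn_leq => /=; move: U2 rU; lia.
(* Here w is r / n rounded up. The coefficient at X^(nw - r) exists because r <= nw. Since w < r,
   expanding (P + u)^w only meets power sums that vanish, apart from the constant term. Since nw <
   p, equality of values gives equality of polynomials, and the binomial of nw over r is nonzero.
   When n < r, the bound nw < p follows from nw <= r + n - 1 < 2|U| < p. *)
pose n := (size P).-1; pose w := ((r + n.-1) %/ n)%N.
have nE : size P = n.+1 by rewrite /n prednK // (leq_trans _ sP2).
have n2 : (1 < n)%N by lia.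
have [w_gt0 wr rnw nwp] : [/\ (0 < w)%N, (w < r)%N, (r <= n * w)%N & (n * w < p)%N].
  have := divn_eq (r + n.-1) n; have := ltn_pmod (r + n.-1) (ltnW n2).
  rewrite -/w; move: (_ %% _)%N => s sn e.
  have [rn|nr] := leqP r n.
    have w1 : w = 1%N by nia.
    by rewrite w1; split; lia.
  split; nia.
pose Q := P ^+ w.
have P0 : P != 0 by rewrite -size_poly_gt0 nE.
have sQ : size Q = (n * w).+1.
  by rewrite -[LHS]prednK ?size_poly_gt0 ?expf_neq0 // size_exp.
have QE : \sum_(u in U) (Q \Po ('X + u%:P)) = Q *+ #|U|.
  apply/eqP; rewrite -subr_eq0; apply/eqP/Fp_poly_eq0.
    apply: leq_trans (size_polyD _ _) _; rewrite size_polyN geq_max.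
    apply/andP; split; last first.
      by rewrite -scaler_nat (leq_trans (size_scale_leq _ _)) // sQ.
    apply: leq_trans (size_sum _ _ _) _; apply/bigmax_leqP=> u _.
    by rewrite size_comp_poly2 ?sQ // size_XaddC.
  move=> i; rewrite !hornerE horner_sum.
  under eq_bigr do rewrite horner_comp !hornerE PE.
  (* The map sending u to pi (i + u) - pi i is a permutation of U, since pi preserves membership of
     differences in U. *)
  have -> : \sum_(u in U) pi (i + u) ^+ w = \sum_(u in U) (pi i + u) ^+ w.
    have fI : injective (fun u => pi (i + u) - pi i).
      by move=> u v /addIr/perm_inj/addrI.
    rewrite [RHS](reindex_inj fI) /=.
    apply: eq_big => [u|u _]; first by rewrite piU addrC addKr.
    by rewrite (addrC (pi i)) subrK.
  under eq_bigr do rewrite exprDn.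
  rewrite exchange_big big_ord_recl /=.
  under eq_bigr do rewrite subn0 expr0 mulr1 bin0 mulr1n.
  rewrite sumr_const hornerMn horner_exp PE big1 ?addr0 ?subrr // => k _.
  rewrite sumrMnl -mulr_sumr pk0 ?mulr0 ?mul0rn //.
  by rewrite /bump /=; have := ltn_ord k; lia.
(* The terms with |U| cancel. What is left says that the leading coefficient of Q, times the r-th
   power sum, times a binomial coefficient, is 0, yet no factor is. *)
have := @coef_sum_shift U Q r; rewrite sQ r_gt0 ltnS rnw => /(_ isT pk0) /=.
rewrite QE coefMn => /eqP; rewrite -subr_eq0 opprD addNKr oppr_eq0.
rewrite -mulr_natl !mulf_eq0 lead_coef_eq0 expf_eq0 (negPf P0) (negPf pr) andbF.
by rewrite (negPf (Fp_bin_neq0 _)) // rnw.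
Qed.

End PrimeField.

(** * Circulant graphs of prime order *)

Definition uniform (V : finType) (G : graph V) (e : bool) : Prop :=
  forall a b, a != b -> G a b = e.

Lemma uniform_iso (V : finType) (G : graph V) (e : bool) m : #|V| = m ->
  uniform G e -> graph_iso G (if e then complete m else edgeless m).
Proof.
move=> <- uG; exists enum_rank; split; first exact: enum_rank_bij.
move=> x y; have [->|xy] := eqVneq x y; first by rewrite !edge_irr.
by rewrite uG //; case: e {uG} => //=; rewrite (inj_eq enum_rank_inj).
Qed.

Lemma iso_uniform (V : finType) (G : graph V) m :
    graph_iso G (complete m) \/ graph_iso G (edgeless m) ->
  exists e, uniform G e.
Proof.
case=> -[f [bf fE]]; [exists true | exists false] => x y xy.
  by rewrite -fE /= (inj_eq (bij_inj bf)).
by rewrite -fE.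
Qed.

Section Circulant.
Import GRing.Theory.
Local Open Scope ring_scope.

Lemma circulant_sub q (S : graph 'Z_q) (i j : 'Z_q) : circulant S -> S i j = S 0 (j - i).
Proof. by move=> cS; rewrite -[RHS](cS i) add0r subrK. Qed.

(** The neighbours and the non-neighbours of 0 split the p - 1 nonzero residues, so the smaller of
    the two sets meets the bound 2|U| < p and pi is affine. An affine map with two fixed points is
    the identity. The type 'Z_(pdiv p) is the carrier of 'F_p, which gives the field structure;
    [pdiv_id] transfers the result to 'Z_p. *)
Lemma Fp_circulant_supp p (S : graph 'Z_(pdiv p)) (pi : {perm 'Z_(pdiv p)}) :
    prime p -> odd p -> circulant S -> ~ (exists e, uniform S e) ->
  pi \in gaut S -> pi != 1%g -> (p.-1 <= #|supp pi|)%N.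
Proof.
move=> p_prime p_odd cS nuS /gautP piS pi1.
have SE i j : S i j = S 0 (j - i) by exact: circulant_sub.
pose U e : {set 'F_p} := [set u | (u != 0) && (S 0 u == e)].
have U0 e : 0 \notin U e by rewrite inE eqxx.
have Un0 e : U e != set0.
  apply/negP=> /eqP Ue0; case: nuS; exists (~~ e) => i j ij.
  have : j - i \notin U e by rewrite Ue0 inE.
  by rewrite inE subr_eq0 eq_sym ij -SE /=; case: (S i j) (e) => -[].
have UN e u : (- u \in U e) = (u \in U e).
  by rewrite !inE oppr_eq0 edge_sym SE opprK add0r.
have Upi e i j : (pi j - pi i \in U e) = (j - i \in U e).
  by rewrite !inE !subr_eq0 (inj_eq perm_inj) -!SE piS.
have cU : (#|U true| + #|U false| = p.-1)%N.
  have UT : U true = [set u | S 0 u].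
    by apply/setP=> u; rewrite !inE eqb_id; case: eqVneq => [->|] //; rewrite edge_irr.
  have UF : U false = ~: U true :\ 0.
    by apply/setP=> u; rewrite UT !inE eqbF_neg.
  have := cardsC (U true); rewrite card_Fp // (cardsD1 0 (~: _)) in_setC U0 -UF add1n.
  by rewrite addnS => /(congr1 predn).
have [e Ue] : exists e, (#|U e|.*2 < p)%N.
  have p_gt0 := prime_gt0 p_prime.
  by case: (leqP #|U true| #|U false|) => ?; [exists true | exists false]; lia.
have [a [b piE]] :=
  difference_preserving_affine p_prime (U0 e) (Un0 e) Ue (UN e) (Upi e).
have : (#|~: supp pi| <= 1)%N.
  apply/card_le1_eqP=> i j; rewrite !inE !negbK => /eqP fi /eqP fj.
  apply/eqP; apply: contraNT pi1 => ij.
  have a1 : a = 1.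
    apply: (@mulIf _ (i - j)); first by rewrite subr_eq0 eq_sym.
    by rewrite mul1r mulrBr -[in RHS]fi -[in RHS]fj !piE opprD addrACA subrr addr0.
  have b0 : b = 0 by apply: (@addrI _ (a * i)); rewrite -piE fi a1 mul1r addr0.
  by apply/eqP/permP=> k; rewrite perm1 piE a1 b0 mul1r addr0.
have := cardsC (supp pi); rewrite card_Fp //.
lia.
Qed.

Lemma circulant_supp p (S : graph 'Z_p) (pi : {perm 'Z_p}) :
    prime p -> (3 <= p)%N -> circulant S -> ~ (exists e, uniform S e) ->
  pi \in gaut S -> pi != 1%g -> (p.-1 <= #|supp pi|)%N.
Proof.
move=> p_prime p3; have p_odd : odd p by case: (even_prime p_prime) p3 => // ->.
move: S pi; have := fun S pi => @Fp_circulant_supp p S pi p_prime p_odd.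
by rewrite pdiv_id.
Qed.

(** If S a b differs from e, then translation by b - a cannot leave Y. As b - a generates the
    additive group, Y would then contain z. *)
Lemma Fp_circulant_split p (S : graph 'Z_(pdiv p)) (Y : {set 'Z_(pdiv p)}) y z e :
    prime p -> circulant S -> y \in Y -> z \notin Y ->
    (forall a b, a \notin Y -> b \in Y -> S a b = e) -> uniform S e.
Proof.
move=> p_prime cS Yy Yz SY a b ab.
have SE i j : S i j = S 0 (j - i) by exact: circulant_sub.
apply/eqP; apply: contraNT Yz => Sab.
have u0 : (b - a : 'F_p) != 0 by rewrite subr_eq0 eq_sym.
have Su i : S i (i + (b - a)) != e by rewrite SE addrC addKr -SE.
have Yu i : i \in Y -> i + (b - a) \in Y.
  move=> iY; apply: contraNT (Su i) => iuY.
  by rewrite edge_sym SY.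
have Yk k : y + (b - a) *+ k \in Y.
  by elim: k => [|k IHk]; rewrite ?addr0 // mulrSr addrA Yu.
have := Yk (nat_of_ord ((z - y) / (b - a) : 'F_p)).
by rewrite -mulr_natr natr_Zp mulrC divfK // addrC subrK.
Qed.

Lemma circulant_split p (S : graph 'Z_p) (Y : {set 'Z_p}) y z e :
    prime p -> circulant S -> y \in Y -> z \notin Y ->
    (forall a b, a \notin Y -> b \in Y -> S a b = e) -> uniform S e.
Proof.
move=> p_prime; move: S Y y z.
have := fun S Y y z => @Fp_circulant_split p S Y y z e p_prime.
by rewrite pdiv_id.
Qed.

Lemma circulant_pos_uniform q (S : graph 'Z_q) i e : circulant S ->
  (forall j, j != i -> S i j = e) -> uniform S e.
Proof.
move=> cS Si a b ab; rewrite -(cS (i - a)) addrC subrK Si //.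
by rewrite addrCA -subr_eq0 addrAC subrr add0r subr_eq0 eq_sym.
Qed.

Lemma circulant_translation q (S : graph 'Z_q) : circulant S ->
  exists2 x, x \in gaut S & forall i, x i = i + 1.
Proof.
move=> cS; exists (perm (addIr (1 : 'Z_q))) => [|i]; last by rewrite permE.
by apply/gautP=> a b; rewrite !permE cS.
Qed.

Lemma circulant_reflection q (S : graph 'Z_q) : circulant S ->
  exists2 x, x \in gaut S & forall i, x i = - i.
Proof.
move=> cS; exists (perm (@oppr_inj 'Z_q)) => [|i]; last by rewrite permE.
by apply/gautP=> a b; rewrite !permE circulant_sub // opprK addrC -circulant_sub // edge_sym.
Qed.

Lemma Fp_opp_fixed p (i : 'Z_(pdiv p)) : prime p -> odd p -> (- i == i) = (i == 0).
Proof.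
move=> p_prime p_odd; rewrite -subr_eq0 -opprD oppr_eq0 -mulr2n -mulr_natl.
rewrite (mulf_eq0 (_ : 'F_p)) Fp_natr_eq0 //.
have -> // : (p %| 2)%N = false.
apply: contraTF p_odd => /dvdn_leq -/(_ isT) p2.
by have -> : p = 2 by move: p2 (prime_gt1 p_prime); lia.
Qed.

Lemma Zp_opp_fixed p (i : 'Z_p) : prime p -> (3 <= p)%N -> (- i == i) = (i == 0).
Proof.
move=> p_prime p3; have p_odd : odd p by case: (even_prime p_prime) p3 => // ->.
by move: i; have := fun i => @Fp_opp_fixed p i p_prime p_odd; rewrite pdiv_id.
Qed.

Lemma card_Zp_prime p : prime p -> #|'Z_p| = p.
Proof. by move=> p_prime; rewrite card_ord Zp_cast ?prime_gt1. Qed.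

End Circulant.

(** * Prime cycles and lexicographic products *)

Section Quotient.

Lemma quotient_type (V T : finType) (cl : V -> T) :
  exists (W : finType) (pi : V -> W) (s : W -> V),
    (forall w, pi (s w) = w) /\ (forall u v, pi u = pi v <-> cl u = cl v).
Proof.
pose W : finType := {t : T | t \in codom cl}.
pose pi v : W := exist _ (cl v) (codom_f cl v).
have sP (w : W) : exists v, pi v == w.
  case: w => t ct; case/codomP: (ct) => v tE; exists v; apply/eqP/val_inj.
  by rewrite /= tE.
exists W, pi, (fun w => xchoose (sP w)); split=> [w|u v].
  exact/eqP/(xchooseP (sP w)).
by split=> [/(congr1 val)|E] //; apply: val_inj.
Qed.

Lemma quotient_perm (V W : finType) (pi : V -> W) (s : W -> V) (g : {perm V}) :
    (forall w, pi (s w) = w) ->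
    (forall u v, pi u = pi v <-> pi (g u) = pi (g v)) ->
  exists h : {perm W}, forall v, h (pi v) = pi (g v).
Proof.
move=> piK gP; have hI : injective (fun w => pi (g (s w))).
  by move=> w w' /(iffRL (gP _ _)); rewrite !piK.
by exists (perm hI) => v; rewrite permE; apply/(iffLR (gP _ _)); rewrite piK.
Qed.

Lemma gaut_invariant_inj (V : finType) (T : eqType) (G : graph V) (cl : V -> T) :
    (forall g u v, g \in gaut G -> cl u = cl v -> cl (g u) = cl (g v)) ->
  forall g u v, g \in gaut G -> cl (g u) = cl (g v) -> cl u = cl v.
Proof.
move=> clG g u v gG E.
by rewrite -(permK g u) -(permK g v); apply: clG; rewrite ?groupV.
Qed.

End Quotient.

Section Induced.
Variables (U V : finType) (f : U -> V) (G : graph V).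

Fact induced_sym : symmetric (fun i j => G (f i) (f j)).
Proof. by move=> i j; rewrite edge_sym. Qed.
Fact induced_irr : irreflexive (fun i j => G (f i) (f j)).
Proof. by move=> i; rewrite edge_irr. Qed.
Definition induced : graph U := Graph induced_sym induced_irr.

End Induced.

(** The fibres of [cl] form an invariant partition into modules, so adjacency between two of them
    depends on the fibres alone and defines Theta. An automorphism chosen for each fibre carries v0
    into it and transports the labelling [psi], which makes every fibre a copy of one graph. *)
Lemma lex_decomposition (V U T : finType) (G : graph V) (cl : V -> T)
    (v0 : V) (psi : U -> V) :
    vertex_transitive G ->
    (forall g u v, g \in gaut G -> cl u = cl v -> cl (g u) = cl (g v)) ->
    (forall u u' v, cl u = cl u' -> cl u <> cl v -> G v u = G v u') ->
    injective psi -> (forall v, cl v = cl v0 <-> exists i, v = psi i) ->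
  exists (W : finType) (Theta : graph W),
    vertex_transitive Theta /\ graph_iso G (lexprod Theta (induced psi G)).
Proof.
move=> /gaut_trans tG clG mod psiI psiP.
have clG2 := gaut_invariant_inj clG.
have [W [pi [s [piK piE]]]] := quotient_type cl.
pose th (w w' : W) := (w != w') && G (s w) (s w').
have th_sym : symmetric th by move=> w w'; rewrite /th eq_sym edge_sym.
have th_irr : irreflexive th by move=> w; rewrite /th eqxx.
have thE u v : pi u != pi v -> th (pi u) (pi v) = G u v.
  move=> uv; rewrite /th uv /=.
  have su : cl (s (pi u)) = cl u by apply/piE.
  have sv : cl (s (pi v)) = cl v by apply/piE.
  rewrite (mod _ v) // => [|E]; last first.
    by case/eqP: uv; apply/piE; rewrite -su -sv E.
  by rewrite edge_sym (mod _ u) 1?edge_sym // => E; case/eqP: uv; apply/piE; rewrite -su E.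
pose Theta := Graph th_sym th_irr; exists W, Theta; split.
  apply: (@transitive_perm _ _ (pi v0)) => w; have [g gG gv0] := tG v0 (s w).
  have [|h hE] := @quotient_perm _ _ pi s g piK.
    by move=> u v; split=> [/piE/(clG _ _ _ gG)/piE|/piE/(clG2 _ _ _ gG)/piE].
  exists h; last by rewrite hE gv0 piK.
  apply/gautP=> a b; rewrite -(piK a) -(piK b) !hE /=.
  have [E|ab] := eqVneq (pi (s a)) (pi (s b)).
    by rewrite E th_irr; move/piE/(clG _ _ _ gG)/piE: E => ->; rewrite th_irr.
  rewrite !thE //; first by move/gautP: gG => ->.
  by apply: contraNneq ab => /piE/(clG2 _ _ _ gG)/piE ->.
have [gg ggP] : exists gg : W -> {perm V}, forall w, (gg w \in gaut G) && (gg w v0 == s w).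
  apply: (@fin_all_exists _ _ (fun w (g : {perm V}) => (g \in gaut G) && (g v0 == s w))) => w.
  by have [g gG gv0] := tG v0 (s w); exists g; rewrite gG gv0 eqxx.
have ggG w : gg w \in gaut G by case/andP: (ggP w).
have gg0 w : gg w v0 = s w by apply/eqP; case/andP: (ggP w).
have clpsi i : cl (psi i) = cl v0 by apply/psiP; exists i.
pose F (u : U * W) := gg u.2 (psi u.1).
have piF u : pi (F u) = u.2.
  by rewrite -[RHS]piK -gg0; apply/piE/clG.
apply: (@graph_iso_inv _ _ _ _ F).
  have FI : injective F.
    move=> [i w] [j w'] E; have := piF (i, w); rewrite E piF /= => ww; subst w'.
    by move/perm_inj/psiI: E => /= ->.
  have Fs v : exists u, F u == v.
    have /psiP[i iE] : cl ((gg (pi v))^-1%g v) = cl v0.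
      by apply: (clG2 _ _ _ (ggG (pi v))); rewrite permKV gg0; apply/piE; rewrite piK.
    by exists (i, pi v); rewrite /F /= -iE permKV.
  exists (fun v => xchoose (Fs v)) => [u|v]; last exact/eqP/(xchooseP (Fs v)).
  exact/FI/eqP/(xchooseP (Fs (F u))).
move=> [i w] [j w']; rewrite /= /lexprod_rel /=.
have [<-|ww] := eqVneq w w'.
  by rewrite th_irr orbF /F /=; move/gautP: (ggG w) => ->.
by have := thE (F (i, w)) (F (j, w')); rewrite !piF /= => <-.
Qed.

(** * Fibres and twins of a lexicographic product *)

Section Lex.
Variables (U W : finType) (Delta : graph U) (Theta : graph W).
Let L := lexprod Theta Delta.

Lemma lex_same i j w : L (i, w) (j, w) = Delta i j.
Proof. by rewrite /= /lexprod_rel /= eqxx edge_irr orbF. Qed.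

Lemma lex_diff i j w w' : w != w' -> L (i, w) (j, w') = Theta w w'.
Proof. by move=> ww; rewrite /= /lexprod_rel /= (negPf ww). Qed.

Lemma lex_fibre_aut x w : x \in gaut Delta ->
  exists y : {perm U * W}, [/\ y \in gaut L, forall i, y (i, w) = (x i, w)
    & supp y = [set (i, w) | i in supp x]].
Proof.
move=> /gautP xD.
pose f (u : U * W) := (if u.2 == w then x u.1 else u.1, u.2).
have fE i v : f (i, v) = (if v == w then x i else i, v) by [].
have fI : injective f.
  move=> [i v] [j v'] [] + E; rewrite -{}E /=.
  by case: ifP => _; [move/perm_inj | ] => ->.
exists (perm fI); split.
- apply/gautP=> -[i v] [j v']; rewrite !permE !fE.
  have [<-|vv] := eqVneq v v'; last by rewrite !lex_diff.
  by rewrite !lex_same; case: ifP.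
- by move=> i; rewrite permE /f /= eqxx.
apply/setP=> -[i v]; rewrite inE permE /f /=; apply/idP/imsetP.
  case: (eqVneq v w) => [-> | _]; last by rewrite eqxx.
  by rewrite xpair_eqE eqxx andbT => xi; exists i; rewrite ?inE.
by case=> j; rewrite inE => xj [-> ->]; rewrite eqxx xpair_eqE eqxx andbT.
Qed.

Lemma lex_twins_same i j w : twins L (i, w) (j, w) = twins Delta i j.
Proof.
apply/twinsP/twinsP => H => [k ki kj|[k v]].
  by rewrite -(lex_same _ _ w) H ?lex_same // xpair_eqE eqxx andbT.
have [->|vw] := eqVneq v w; last by rewrite !lex_diff.
by rewrite !xpair_eqE eqxx !andbT !lex_same; exact: H.
Qed.

Lemma lex_twins_diff i j w w' k : w != w' ->
  twins L (i, w) (j, w') -> k != i -> Delta i k = Theta w w'.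
Proof.
move=> ww /twinsP/(_ (k, w)) H ki.
rewrite edge_sym -(lex_same _ _ w) H ?xpair_eqE ?eqxx ?andbT ?(negPf ww) ?andbF //.
by rewrite lex_diff.
Qed.

(** Twins in one fibre are twins of Delta. Twins in two fibres would give the first of them the same
    adjacency to all the rest of its fibre, so it suffices that every vertex of Delta has both a
    neighbour and a non-neighbour. *)
Lemma lex_twin_free : twin_free Delta ->
  (forall i e, exists2 j, j != i & Delta i j != e) -> twin_free L.
Proof.
move=> tf nd [i w] [j w'] t; have [ww|ww] := eqVneq w w'.
  by subst w'; move: t; rewrite lex_twins_same => /tf ->.
have [k ki] := nd i (Theta w w').
by rewrite (lex_twins_diff ww t ki) eqxx.
Qed.

Lemma uniform_lex_motion e : W -> 1 < #|U| -> uniform Delta e -> motion L = 2.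
Proof.
move=> w /card_gt1P[i [j [_ _ ij]]] uD.
apply: (@twins_motion _ _ (i, w) (j, w)); first by rewrite xpair_eqE eqxx andbT.
rewrite lex_twins_same; apply/twinsP=> k ki kj.
by rewrite !uD.
Qed.

End Lex.

Section Cycles.
Import GRing.Theory.
Local Open Scope ring_scope.
Variable V : finType.
Implicit Types (x y : {perm V}) (G : graph V).

Lemma is_cycle_of_labelling q x (psi : 'Z_q -> V) : (1 < q)%N -> injective psi ->
    (forall i, x (psi i) = psi (i + 1)) ->
    (forall v, x v != v -> exists i, v = psi i) ->
  is_cycle q x.
Proof.
move=> q1 psiI xpsi psiP.
have xk k : (x ^+ k)%g (psi 0) = psi k%:R.
  elim: k => [|k IHk]; first by rewrite expg0 perm1.
  by rewrite expgSr permM IHk xpsi mulrSr.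
have sE : supp x = [set psi i | i in 'Z_q].
  apply/setP=> v; apply/idP/imsetP => [|[i _ ->]]; rewrite inE.
    by case/psiP=> i ->; exists i.
  by rewrite xpsi (inj_eq psiI) -subr_eq0 addrAC subrr add0r oner_neq0.
apply/andP; split; last by rewrite sE card_imset // card_ord Zp_cast.
apply/existsP; exists (psi 0); apply/eqP/setP=> v; rewrite sE.
apply/imsetP/porbitP => [[i _ ->]|[k ->]]; last by exists k%:R.
by exists (nat_of_ord i); rewrite xk natr_Zp.
Qed.

Lemma cycle_labelling q x : (1 < q)%N -> is_cycle q x ->
  exists psi : 'Z_q -> V, [/\ injective psi, forall i, x (psi i) = psi (i + 1)
    & forall v, (v \in supp x) <-> exists i, v = psi i].
Proof.
move=> q1 /andP[/existsP[w /eqP sE] /eqP cs].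
have xq : (x ^+ q)%g w = w by rewrite permX -cs sE iter_porbit.
have xmod k : (x ^+ k)%g w = (x ^+ (k %% q))%g w.
  rewrite {1}(divn_eq k q) expgD permM mulnC expgM; congr (_ _).
  by elim: (k %/ q)%N => [|l IHl]; rewrite ?expg0 ?perm1 // expgSr permM IHl.
pose psi (i : 'Z_q) := (x ^+ i)%g w.
have sP v : (v \in supp x) <-> exists i, v = psi i.
  rewrite sE; split=> [/porbitP[k ->]|[i ->]]; last exact: mem_porbit.
  have kq : (k %% q < (Zp_trunc q).+2)%N by rewrite Zp_cast // ltn_mod ltnW.
  by exists (Ordinal kq); rewrite /psi /= xmod.
exists psi; split=> // [|i]; last first.
  have -> : i + 1 = (nat_of_ord i).+1%:R :> 'Z_q by rewrite mulrSr natr_Zp.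
  by rewrite /psi -permM -expgSr val_Zp_nat // -xmod.
have sI : supp x = psi @: [set: 'Z_q].
  apply/setP=> v; apply/idP/imsetP => [/sP[i ->]|[i _ ->]]; first by exists i.
  by apply/sP; exists i.
have /imset_injP psiI : #|psi @: [set: 'Z_q]| == #|[set: 'Z_q]|.
  by rewrite -sI cs cardsT card_ord Zp_cast.
by move=> i j; apply: psiI; rewrite inE.
Qed.

Lemma labelling_circulant q x (psi : 'Z_q -> V) G : x \in gaut G ->
  (forall i, x (psi i) = psi (i + 1)) -> circulant (induced psi G).
Proof.
move=> /gautP xG xpsi c i j; rewrite -(natr_Zp c).
elim: (nat_of_ord c) => [|k IHk]; first by rewrite !addr0.
by rewrite mulrSr !addrA /= -!xpsi xG.
Qed.

(** Some power of x carries a to b, and it fixes v. *)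
Lemma cycle_module q x G a b v : x \in gaut G -> is_cycle q x ->
  a \in supp x -> b \in supp x -> v \notin supp x -> G v a = G v b.
Proof.
move=> xG /andP[/existsP[w /eqP sE] _]; rewrite sE porbit_sym => aw bw.
have /porbitP[k ->] : b \in porbit x a.
  by move: aw; rewrite -eq_porbit_mem => /eqP <-.
rewrite -sE inE negbK => /eqP xv.
have /gautP <- : (x ^+ k)%g \in gaut G by rewrite groupX.
by congr (G _ _); elim: k => [|k IHk]; rewrite ?expg0 ?perm1 // expgSr permM IHk.
Qed.

Lemma uniform_cycle_not_twin_free q x (psi : 'Z_q -> V) G e :
    (1 < q)%N -> x \in gaut G -> is_cycle q x -> injective psi ->
    (forall v, (v \in supp x) <-> exists i, v = psi i) ->
    uniform (induced psi G) e -> ~ twin_free G.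
Proof.
move=> q1 xG cx psiI psiP uS tf.
suff /tf/psiI/eqP : twins G (psi 0) (psi 1) by rewrite eq_sym oner_eq0.
apply/twinsP=> v v0 v1; case: (boolP (v \in supp x)) => [/psiP[i iE]|vx].
  subst v; rewrite (inj_eq psiI) in v0; rewrite (inj_eq psiI) in v1.
  by have := uS _ _ v0; have := uS _ _ v1; rewrite /= => -> ->.
by apply: (cycle_module xG cx) => //; apply/psiP; [exists 0 | exists 1].
Qed.

(* Both supports are modules of [G]. Hence one adjacency value holds between
   [supp x :\: supp y] and [supp x :&: supp y], and [circulant_split] makes
   [supp x] a clique or a coclique, whose points are twins. *)
Lemma cycle_supp_overlap p x y G a : prime p -> twin_free G ->
    x \in gaut G -> y \in gaut G -> is_cycle p x -> is_cycle p y ->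
    a \in supp x -> a \in supp y -> supp x = supp y.
Proof.
move=> p_prime tf xG yG cx cy ax ay; apply/eqP; apply/negPn/negP=> xy.
have [/andP[_ /eqP sx] /andP[_ /eqP sy]] := (cx, cy).
have /subsetPn[c cY cX] : ~~ (supp y \subset supp x).
  by apply: contra xy => yx; rewrite eq_sym eqEcard yx sx sy leqnn.
have /subsetPn[d dX dY] : ~~ (supp x \subset supp y).
  by apply: contra xy => yx; rewrite eqEcard yx sx sy leqnn.
have [psi [psiI xpsi psiP]] := cycle_labelling (prime_gt1 p_prime) cx.
have /psiP[i iE] := ax; have /psiP[j jE] := dX.
apply: (@uniform_cycle_not_twin_free p x psi G (G d c) (prime_gt1 p_prime) xG cx psiI psiP _ tf).
apply: (@circulant_split _ _ [set i | psi i \in supp y] i j) => //.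
- exact: labelling_circulant xpsi.
- by rewrite inE -iE.
- by rewrite inE -jE.
(* The module [supp y] allows [psi l] to be replaced by c, and then the module [supp x] allows
   [psi k] to be replaced by d. *)
move=> k l; rewrite inE => ky; rewrite inE => ly; rewrite /=.
rewrite (cycle_module yG cy ly cY ky) edge_sym [RHS]edge_sym.
by apply: (cycle_module xG cx) => //; apply/psiP; exists k.
Qed.

Lemma supp_conj x (g : {perm V}) v : (g v \in supp (x ^ g)%g) = (v \in supp x).
Proof. by rewrite !inE /conjg !permM permK (inj_eq perm_inj). Qed.

Lemma is_cycleJ q x g : is_cycle q x -> is_cycle q (x ^ g)%g.
Proof.
have sJ : supp (x ^ g)%g = g @: supp x.
  apply/setP=> v; rewrite -(permKV g v) supp_conj mem_imset //.
  exact: perm_inj.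
case/andP=> /existsP[w /eqP sE] cs; apply/andP; split; last first.
  by rewrite sJ card_imset //; exact: perm_inj.
apply/existsP; exists (g w); rewrite sJ sE; apply/eqP/setP=> v.
apply/imsetP/porbitP => [[u /porbitP[k ->] ->]|[k ->]].
  by exists k; rewrite -conjXg /conjg !permM permK.
by exists ((x ^+ k)%g w); rewrite ?mem_porbit // -conjXg /conjg !permM permK.
Qed.

Lemma cycle_lex p x G : prime p -> vertex_transitive G -> twin_free G ->
    x \in gaut G -> is_cycle p x ->
  exists (S : graph 'Z_p) (W : finType) (Theta : graph W),
    [/\ circulant S, ~ (exists e, uniform S e), vertex_transitive Theta
      & graph_iso G (lexprod Theta S)].
Proof.
move=> p_prime tG tf xG cx; have p1 := prime_gt1 p_prime.
have [psi [psiI xpsi psiP]] := cycle_labelling p1 cx.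
(* The union of the supports of all p-cycles that move v. Supports that meet coincide, so this is a
   single support; conjugates of x provide one for every v. *)
pose cl v := [set u | [exists y in gaut G, [&& is_cycle p y, v \in supp y & u \in supp y]]].
have clE y v : y \in gaut G -> is_cycle p y -> v \in supp y -> cl v = supp y.
  move=> yG cy vy; apply/setP=> u; rewrite inE; apply/existsP/idP.
    case=> z /and4P[zG cz vz uz].
    by rewrite (cycle_supp_overlap p_prime tf yG zG cy cz vy vz).
  by move=> uy; exists y; rewrite yG cy vy uy.
have x0 : psi 0 \in supp x by apply/psiP; exists 0.
have cover v : exists y, [/\ y \in gaut G, is_cycle p y & v \in supp y].
  have [g gG <-] := gaut_trans tG (psi 0) v.
  by exists (x ^ g)%g; rewrite supp_conj groupJ ?is_cycleJ.
have clP y u v : y \in gaut G -> is_cycle p y -> v \in supp y ->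
    (cl u = cl v <-> u \in supp y).
  move=> yG cy vy; split=> [|uy]; last by rewrite !(clE y).
  have [z [zG cz uz]] := cover u.
  by rewrite (clE y v) // (clE z u) // => <-.
have [W [Theta [tT iT]]] : exists (W : finType) (Theta : graph W),
    vertex_transitive Theta /\ graph_iso G (lexprod Theta (induced psi G)).
  apply: (@lex_decomposition _ _ _ _ cl (psi 0)) => //.
  - move=> g u v gG; have [y [yG cy vy]] := cover v.
    move/(clP y) => /(_ yG cy vy) uy.
    by apply/(clP (y ^ g)%g); rewrite ?supp_conj ?groupJ ?is_cycleJ.
  - move=> u u' v; have [y [yG cy uy]] := cover u.
    move=> /esym/(clP y) -/(_ yG cy uy) u'y /nesym uv.
    apply: (cycle_module yG cy) => //; apply/negP=> vy.
    by case: uv; apply/(clP y).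
  by move=> v; rewrite -psiP; apply: clP.
exists (induced psi G), W, Theta; split=> //.
  exact: labelling_circulant xpsi.
by case=> e /(uniform_cycle_not_twin_free p1 xG cx psiI psiP).
Qed.

End Cycles.

(** * Motion of Theta[S] for a circulant S of prime order *)

Section CirculantLex.
Import GRing.Theory.
Local Open Scope ring_scope.

(** The transposition of two twins moves only two points, so p - 1 <= 2 and p = 3. The third vertex
    then sees both twins alike, and translations make S uniform. *)
Lemma circulant_twin_free p (S : graph 'Z_p) : prime p -> (3 <= p)%N ->
  circulant S -> ~ (exists e, uniform S e) -> twin_free S.
Proof.
move=> p_prime p3 cS nuS a b tab; apply/eqP/negPn/negP=> ab.
have tS : tperm a b \in gaut S by rewrite tperm_gaut.
have t1 : tperm a b != 1%g.
  apply: contraNneq ab => /permP/(_ a); rewrite tpermL perm1 => ->.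
  by rewrite eqxx.
have := circulant_supp p_prime p3 cS nuS tS t1; rewrite supp_tperm // cards2 ab.
move=> p_le; have {p_le}pE : p = 3 by lia.
have [c] : exists c, c \notin [set a; b].
  apply/existsP; rewrite -negb_forall; apply/negP=> /forallP abT.
  have := card_Zp_prime p_prime; rewrite -cardsT.
  have -> : [set: 'Z_p] = [set a; b] by apply/setP=> c; rewrite abT inE.
  by rewrite cards2 ab pE.
rewrite !inE negb_or => /andP[ca cb]; case: nuS; exists (S c a).
apply: (circulant_pos_uniform cS) => j jc.
have : j \in [set a; b].
  apply: contraTT (leqnn p) => jab; rewrite -ltnNge.
  rewrite -{2}(card_Zp_prime p_prime).
  apply: (@leq_trans #|c |: (j |: [set a; b])|); last exact: max_card.
  rewrite !cardsU1 jab cards1 !inE [c == j]eq_sym (negPf jc) (negPf ca) (negPf cb) ab.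
  by rewrite pE.
by rewrite !inE => /orP[] /eqP -> //; move/twinsP: tab => ->.
Qed.

(** The reflection of one fibre moves p - 1 points. Conversely, let g move a point of the fibre over
    w, which is the support of a p-cycle y. If g sends some point of the fibre into the fibre, the
    supports of y and of its conjugate meet, hence coincide, and g induces a nontrivial automorphism
    of S. Otherwise g moves all p points of the fibre. *)
Lemma lex_circulant_motion p (S : graph 'Z_p) (W : finType) (Theta : graph W) :
    prime p -> (3 <= p)%N -> circulant S -> ~ (exists e, uniform S e) -> W ->
  motion (lexprod Theta S) = p.-1.
Proof.
move=> p_prime p3 cS nuS w0; set L := lexprod _ _; have p1 := prime_gt1 p_prime.
have tfS := circulant_twin_free p_prime p3 cS nuS.
have tfL : twin_free L.
  apply: lex_twin_free tfS _ => i e; apply/exists_inP; apply: contraT.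
  rewrite negb_exists_in => /forall_inP iS; case: nuS; exists e.
  by apply: (circulant_pos_uniform cS) => j ji; have := iS j ji; rewrite negbK => /eqP.
apply: motionP.
  have [x xS xE] := circulant_reflection cS.
  have [y [yL _ sy]] := lex_fibre_aut Theta w0 xS; exists y => //.
  have cy : #|supp y| = p.-1.
    rewrite sy card_imset => [|i j [] //].
    have -> : supp x = [set~ 0].
      by apply/setP=> i; rewrite !inE xE Zp_opp_fixed.
    by rewrite cardsC1 card_Zp_prime.
  split=> //; apply/eqP=> y1; move: cy; rewrite y1 supp1 cards0; lia.
move=> g gL g1; have [[i w] gi] := moved_point g1.
have [x xS xE] := circulant_translation cS.
have [y [yL yE sy]] := lex_fibre_aut Theta w xS.
have yP v : (v \in supp y) = (v.2 == w).
  rewrite sy; apply/imsetP/eqP => [[j _ ->] //|<-].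
  exists v.1; last by case: v.
  by rewrite inE xE -subr_eq0 addrAC subrr add0r oner_neq0.
have wI : injective (fun j : 'Z_p => (j, w)) by move=> j k [].
have cy : is_cycle p y.
  apply: (@is_cycle_of_labelling _ p y (fun j => (j, w)) p1 wI) => [j|v].
    by rewrite yE xE.
  by move=> yv; have := yP v; rewrite inE yv => /esym/eqP <-; exists v.1; case: v {yv}.
have [[v vw gvw]|nov] : (exists2 v, v.2 == w & (g v).2 == w) \/
    (forall v, v.2 == w -> (g v).2 != w).
  case: (boolP [exists v in supp y, g v \in supp y]) => [/exists_inP[v]|].
    by rewrite !yP; left; exists v.
  rewrite negb_exists_in => /forall_inP H; right=> v vw.
  by have := H v; rewrite !yP; apply.
  have sE : supp (y ^ g)%g = supp y.
    apply: (@cycle_supp_overlap _ _ _ _ _ (g v) p_prime tfL) => //.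
    - by rewrite groupJ.
    - exact: is_cycleJ.
    - by rewrite supp_conj yP.
    - by rewrite yP.
  have gw j : g (j, w) = ((g (j, w)).1, w).
    have : (g (j, w)).2 == w by rewrite -yP -sE supp_conj yP.
    by case: (g (j, w)) => a b /= /eqP ->.
  have hI : injective (fun j => (g (j, w)).1).
    by move=> j k E; apply/wI/(@perm_inj _ g); rewrite gw E -gw.
  have hS : perm hI \in gaut S.
    apply/gautP=> j k; rewrite !permE -(lex_same S Theta _ _ w) -!gw.
    by move/gautP: gL => ->; rewrite lex_same.
  have h1 : perm hI != 1%g.
    apply: contraNneq gi => h1; have gi1 : (g (i, w)).1 = i by rewrite -(permE hI) h1 perm1.
    by rewrite gw gi1.
  apply: leq_trans (circulant_supp p_prime p3 cS nuS hS h1) _.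
  rewrite -(card_imset _ wI); apply/subset_leq_card/subsetP=> v' /imsetP[j jh ->].
  move: jh; rewrite !inE permE; apply: contraNN => /eqP E.
  by rewrite E.
apply: (@leq_trans #|supp y|); first by case/andP: cy => _ /eqP ->; lia.
apply/subset_leq_card/subsetP=> v; rewrite yP inE => vw.
by apply: contraTneq (nov v vw) => ->; rewrite vw.
Qed.

End CirculantLex.

Lemma graph_iso_trans (U V W : finType) (G : graph U) (H : graph V) (K : graph W) :
  graph_iso G H -> graph_iso H K -> graph_iso G K.
Proof.
move=> [f [bf fE]] [g [bg gE]]; exists (g \o f); split; first exact: bij_comp.
by move=> x y; rewrite /= gE fE.
Qed.

Lemma lexprod_iso (U V W : finType) (Theta : graph W) (G : graph U) (H : graph V) :
  graph_iso G H -> graph_iso (lexprod Theta G) (lexprod Theta H).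
Proof.
move=> [f [[g fK gK] fE]]; exists (fun u => (f u.1, u.2)); split.
  by exists (fun v => (g v.1, v.2)) => -[i w] /=; rewrite ?fK ?gK.
by move=> u v; rewrite /= /lexprod_rel /= fE.
Qed.

Lemma uniform_of_stars (V : finType) (G : graph V) :
    (forall a b c, a != b -> a != c -> G a b = G a c) ->
  exists e, uniform G e.
Proof.
move=> star; have [/existsP[a /existsP[b ab]]|nE] := boolP [exists a, exists b, G a b].
  have nab : a != b by apply: contraTneq ab => ->; rewrite edge_irr.
  exists true => x y xy; rewrite -ab; have [ay|ay] := eqVneq a y.
    by subst y; rewrite edge_sym; apply: star; rewrite // eq_sym.
  by rewrite (star a b y) // edge_sym [RHS]edge_sym; apply: star; rewrite eq_sym.
exists false => x y _; apply: contraNF nE => Gxy.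
by apply/existsP; exists x; apply/existsP; exists y.
Qed.

Lemma twins_stars (V : finType) (G : graph V) (a b c : V) :
  twins G b c -> a != b -> a != c -> G a b = G a c.
Proof. by move/twinsP; apply. Qed.

Lemma class_labelling (V T : finType) (cl : V -> T) (v0 : V) :
  exists psi : 'I_#|[set v | cl v == cl v0]| -> V,
    injective psi /\ (forall v, cl v = cl v0 <-> exists i, v = psi i).
Proof.
exists enum_val; split; first exact: enum_val_inj.
move=> v; split=> [E|[i ->]]; last by have := enum_valP i; rewrite inE => /eqP.
have vC : v \in [set v | cl v == cl v0] by rewrite inE E.
by exists (enum_rank_in vC v); rewrite enum_rankK_in.
Qed.

(** Twin classes are modules, and adjacency is constant inside a class because any member sees two
    others alike. *)
Lemma twins_lex_K_form (V : finType) (G : graph V) :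
  vertex_transitive G -> motion G = 2 -> lex_K_form #|V| G.
Proof.
move=> tG /motion2_twins[a [b [ab tab]]].
pose cl v := [set u | twins G v u].
have clP u v : cl u = cl v <-> twins G u v.
  split=> [/setP/(_ v)|uv]; first by rewrite !inE twins_refl.
  apply/setP=> w; rewrite !inE; apply/idP/idP; apply: twins_trans => //.
  by rewrite twins_sym.
have [psi [psiI psiP]] := class_labelling cl a; set m := #|_| in psi psiI psiP.
have m2 : 2 <= m.
  apply/card_gt1P; exists a, b; rewrite !inE eqxx; split=> //.
  by apply/eqP/clP; rewrite twins_sym.
have psi_twins i j : twins G (psi i) (psi j).
  apply/clP; transitivity (cl a); first by apply/psiP; exists i.
  by apply/esym/psiP; exists j.
have [e eU] : exists e, uniform (induced psi G) e.
  apply: uniform_of_stars => i j k ij ik /=.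
  by apply: twins_stars; rewrite ?(inj_eq psiI).
have [||//|//|W [Theta [tT iT]]] := @lex_decomposition _ _ _ G cl a psi tG.
- by move=> g u v gG /clP uv; apply/clP; rewrite twins_gaut.
- move=> u u' v uu' uv; apply: twins_stars; first exact/clP.
    by apply/eqP=> vu; case: uv; rewrite vu.
  by apply/eqP=> vu; case: uv; rewrite vu.
exists #|W|, m, W, Theta; split=> //.
  by case: iT => f [bf _]; rewrite (bij_eq_card bf) card_prod card_ord.
have := graph_iso_trans iT (lexprod_iso Theta (uniform_iso (card_ord m) eU)).
by case: e {eU} => ?; [left | right].
Qed.

(** * Circulant graphs on five vertices *)

Section Pentagon.
Import GRing.Theory.
Local Open Scope ring_scope.

Lemma C5_circulant : circulant (C5 : graph 'Z_5).
Proof.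
move=> c x y; apply/eqP; move: c x y.
by do 3![case=> [[|[|[|[|[|//]]]]] ?]].
Qed.

Lemma C5_not_uniform : ~ (exists e, uniform C5 e).
Proof.
case=> e eU; have := eU (inord 0) (inord 1); have := eU (inord 0) (inord 2).
rewrite -!val_eqE /= /C5_rel !inordK //= => <- // H.
by have := H isT.
Qed.

(** The connection set is a union of {1, -1} and {2, -2}, and exactly one of them occurs. Doubling
    exchanges the two. *)
Lemma circulant5_C5 (S : graph 'Z_5) :
  circulant S -> ~ (exists e, uniform S e) -> graph_iso S C5.
Proof.
move=> cS nuS; pose s1 := S 0 1; pose s2 := S 0 2%:R.
have SE i j : S i j = if i == j then false else if C5 i j then s1 else s2.
  have S3 : S 0 3%:R = s2 by rewrite edge_sym circulant_sub //; congr (S 0 _); apply: val_inj.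
  have S4 : S 0 4%:R = s1 by rewrite edge_sym circulant_sub //; congr (S 0 _); apply: val_inj.
  rewrite circulant_sub //.
  have [k kE] : exists k : 'Z_5, k = j - i by exists (j - i).
  rewrite -kE.
  have -> : S 0 k = if k == 0 then false else if (k == 1) || (k == 4%:R) then s1 else s2.
    case: k {kE} => [[|[|[|[|[|//]]]]] lt]; rewrite -!val_eqE /=.
    - by rewrite -[RHS](edge_irr S 0); congr (S 0 _); apply: val_inj.
    - by congr (S 0 _); apply: val_inj.
    - by congr (S 0 _); apply: val_inj.
    - by rewrite -S3; congr (S 0 _); apply: val_inj.
    - by rewrite -S4; congr (S 0 _); apply: val_inj.
  rewrite {}kE; move: i j.
  by do 2![case=> [[|[|[|[|[|//]]]]] ?]].
have s12 : s1 != s2.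
  apply/eqP=> s12; case: nuS; exists s1 => i j /negPf ij.
  by rewrite SE ij -s12 if_same.
case s1E: s1 s12 => s12.
  exists id; split; first by exists id.
  have s2E : s2 = false by move: s12; case: (s2).
  move=> i j; rewrite SE s1E s2E.
  by case: eqVneq => [->|_]; rewrite ?edge_irr //; case: (C5 i j).
have s2E : s2 = true by move: s12; case: (s2).
exists (fun i : 'Z_5 => i *+ 2); split.
  exists (fun i : 'Z_5 => i *+ 3) => i;
  by case: i => [[|[|[|[|[|//]]]]] ?]; apply: val_inj.
move=> i j; rewrite SE s1E s2E; apply/eqP; move: i j {s1E s2E s12}.
by do 2![case=> [[|[|[|[|[|//]]]]] ?]].
Qed.

End Pentagon.

(** * Double transpositions *)

Section DoubleSwaps.
Variables (V : finType) (G : graph V).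
Implicit Types (a b c d e f g k u v : V).

Definition dswap a b c d : bool :=
  uniq [:: a; b; c; d] && (tperm a b * tperm c d \in gaut G)%g.

Lemma uniq4E a b c d : uniq [:: a; b; c; d] =
  [&& a != b, a != c, a != d, b != c, b != d & c != d].
Proof. by rewrite /= !inE !negb_or -!andbA andbT. Qed.

Lemma tperm2E a b c d v : uniq [:: a; b; c; d] ->
  (tperm a b * tperm c d)%g v =
    if v == a then b else if v == b then a else if v == c then d
    else if v == d then c else v.
Proof.
rewrite uniq4E => /and5P[ab ac ad bc /andP[bd cd]]; rewrite permM.
case: (eqVneq v a) => [->|va]; first by rewrite tpermL tpermD // eq_sym.
case: (eqVneq v b) => [->|vb]; first by rewrite tpermR tpermD // eq_sym.
have -> : tperm a b v = v by rewrite tpermD // eq_sym.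
case: (eqVneq v c) => [->|vc]; first by rewrite tpermL.
by case: (eqVneq v d) => [->|vd]; rewrite ?tpermR // tpermD // eq_sym.
Qed.

Lemma dswap_distinct a b c d : dswap a b c d -> uniq [:: a; b; c; d].
Proof. by case/andP. Qed.

Lemma dswapCl a b c d : dswap a b c d = dswap b a c d.
Proof.
by rewrite /dswap tpermC (perm_uniq (permEl (perm_catCA [:: a] [:: b] [:: c; d]))).
Qed.

Lemma dswapCA a b c d : dswap a b c d = dswap c d a b.
Proof.
rewrite /dswap; have := perm_uniq (permEl (perm_catC [:: a; b] [:: c; d])).
rewrite ![_ ++ _]/= => <-; case: (boolP (uniq _)) => // U.
suff -> : (tperm a b * tperm c d)%g = (tperm c d * tperm a b)%g by [].
have U' : uniq [:: c; d; a; b] by rewrite (perm_uniq (permEl (perm_catC [:: c; d] [:: a; b]))).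
apply/permP=> v; rewrite !tperm2E //.
move: U; rewrite uniq4E => /and5P[ab ac ad bc /andP[bd cd]].
case: (eqVneq v a) => [->|va]; first by rewrite (negPf ac) (negPf ad).
by case: (eqVneq v b) => [->|vb]; first by rewrite (negPf bc) (negPf bd).
Qed.

Lemma dswapCr a b c d : dswap a b c d = dswap a b d c.
Proof. by rewrite dswapCA dswapCl dswapCA. Qed.

Lemma dswap_gaut (x : {perm V}) a b c d : x \in gaut G ->
  dswap (x a) (x b) (x c) (x d) = dswap a b c d.
Proof.
move=> xG; rewrite /dswap; congr (_ && _).
  exact: (map_inj_uniq (@perm_inj _ x) [:: a; b; c; d]).
by rewrite -!tpermJ -conjMg groupJr.
Qed.

(** Conjugation of the second involution by the first. The action is spelled out as nested
    conditionals so that rewriting with known inequalities evaluates it. *)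
Lemma dswapJ a b c d e f g k : dswap a b c d -> dswap e f g k ->
  let x v := if v == a then b else if v == b then a else if v == c then d
    else if v == d then c else v in is_true (dswap (x e) (x f) (x g) (x k)).
Proof.
case/andP=> U xG efgk x.
have xE v : x v = (tperm a b * tperm c d)%g v by rewrite tperm2E.
by rewrite !xE dswap_gaut.
Qed.

Lemma dswap_edges a b c d : dswap a b c d ->
  [/\ G a c = G b d, G a d = G b c
    & forall v, v \notin [:: a; b; c; d] -> G v a = G v b /\ G v c = G v d].
Proof.
case/andP=> U /gautP xG; have xE v := tperm2E v U.
move: (U); rewrite uniq4E => /and5P[ab ac ad bc /andP[bd cd]].
have [ba ca da] : [/\ b != a, c != a & d != a] by rewrite ![_ == a]eq_sym.
have [cb db dc] : [/\ c != b, d != b & d != c] by rewrite ![_ == b]eq_sym [d == c]eq_sym.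
have xa : (tperm a b * tperm c d)%g a = b by rewrite xE eqxx.
have xc : (tperm a b * tperm c d)%g c = d.
  by rewrite xE eqxx (negPf ca) (negPf cb).
have xd : (tperm a b * tperm c d)%g d = c.
  by rewrite xE eqxx (negPf da) (negPf db) (negPf dc).
split; first by rewrite -xG xa xc.
  by rewrite -xG xa xd.
move=> v; rewrite !inE !negb_or => /and4P[va vb vc vd].
have xv : (tperm a b * tperm c d)%g v = v.
  by rewrite xE (negPf va) (negPf vb) (negPf vc) (negPf vd).
by rewrite -(xG v a) -(xG v c) xv xa xc.
Qed.

Hypothesis tf : twin_free G.

(** Otherwise c and d would see a and b alike, as every vertex outside the support does, and a and b
    would be twins. *)
Lemma dswap_neq a b c d : dswap a b c d -> G a c != G a d.
Proof.
move=> D; have [E1 E2 E3] := dswap_edges D.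
move: (dswap_distinct D); rewrite uniq4E => /and5P[ab ac ad bc /andP[bd cd]].
apply/eqP=> acd; case/eqP: ab; apply: tf; apply/twinsP=> v va vb.
have [->|vc] := eqVneq v c; first by rewrite edge_sym acd E2 edge_sym.
have [->|vd] := eqVneq v d; first by rewrite edge_sym -acd E1 edge_sym.
by have [] := E3 v; rewrite ?inE ?negb_or ?va ?vb ?vc.
Qed.

Lemma dswap_moved a b c d v : dswap a b c d -> v != a -> v != b ->
  (G v a != G v b) = (v == c) || (v == d).
Proof.
move=> D va vb; have [E1 E2 E3] := dswap_edges D.
have [->|vc] := eqVneq v c.
  by rewrite edge_sym [G c b]edge_sym -E2 (dswap_neq D).
have [->|vd] := eqVneq v d.
  by rewrite edge_sym [G d b]edge_sym -E1 eq_sym (dswap_neq D).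
by have [|-> _] := E3 v; rewrite ?eqxx // !inE !negb_or va vb vc.
Qed.

Lemma dswap_pair a b c d e f : dswap a b c d -> dswap a b e f ->
  (e == c) || (e == d).
Proof.
move=> D D'; move: (dswap_distinct D'); rewrite uniq4E => /and5P[ab ae af be _].
have [ea eb] : e != a /\ e != b by rewrite !(eq_sym e).
by rewrite -(dswap_moved D ea eb) (dswap_moved D' ea eb) eqxx.
Qed.

(* Otherwise the adjacencies of [a] with [b], [c] and [d] would be three
   pairwise distinct booleans. *)
Lemma dswap_klein a b c d : dswap a b c d -> dswap b c a d -> False.
Proof.
move=> D D'; have [E1 E2 E3] := dswap_edges D; have [F1 F2 F3] := dswap_edges D'.
have := dswap_neq D; have := dswap_neq D'; rewrite F2 [G c a]edge_sym => n1 n2.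
have abd : G a b = G a d.
  by rewrite edge_sym; move: n1 n2; case: (G b a) (G a c) (G a d) => [] [] [].
move: (dswap_distinct D); rewrite uniq4E => /and5P[ab ac ad bc /andP[bd cd]].
case/eqP: bd; apply: tf; apply/twinsP=> v vb vd.
have [->//|va] := eqVneq v a.
have [->|vc] := eqVneq v c; first by rewrite -F1 edge_sym -E2 -abd edge_sym.
have vn : v \notin [:: a; b; c; d] by rewrite !inE !negb_or va vb vc.
have vn' : v \notin [:: b; c; a; d] by rewrite !inE !negb_or va vb vc.
by have [_ <-] := E3 v vn; have [-> _] := F3 v vn'.
Qed.

(* The two double transpositions generate the dihedral group of the 5-cycle. *)
Definition pentagon : Prop := exists a b c d e,
  [/\ uniq [:: a; b; c; d; e], dswap a b c d & dswap b c d e].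

Lemma pentagon_C5 : vertex_transitive G -> pentagon ->
  exists (W : finType) (Theta : graph W),
    vertex_transitive Theta /\ graph_iso G (lexprod Theta C5).
Proof.
move=> tG [a [b [c [d [e [U D1 D2]]]]]].
pose z := ((tperm a b * tperm c d) * (tperm b c * tperm d e))%g.
have zG : z \in gaut G by rewrite groupM //; [case/andP: D1 | case/andP: D2].
have zE v : z v = let y := if v == a then b else if v == b then a else
    if v == c then d else if v == d then c else v in
    if y == b then c else if y == c then b else if y == d then e else
    if y == e then d else y.
  by rewrite permM !tperm2E //; exact: dswap_distinct.
move: U; rewrite /= !inE !negb_or -!andbA.
case/and5P=> ab ac ad ae /and5P[bc bd be cd /and3P[ce de _]].
(* The order in which z runs through the five points. *)
pose s := [:: a; c; e; d; b].
pose psi (i : 'Z_5) := nth a s i.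
have psiI : injective psi.
  move=> i j /eqP; rewrite nth_uniq //; first by move/eqP/val_inj.
  by rewrite /= !inE !negb_or ab ac ad ae cd ce [c == b]eq_sym bc [e == d]eq_sym de
    [e == b]eq_sym be [d == b]eq_sym bd.
have cz : is_cycle 5 z.
  apply: (is_cycle_of_labelling _ psiI) => // [i|v].
    have [ba ca da ea] : [/\ b != a, c != a, d != a & e != a] by rewrite ![_ == a]eq_sym.
    have [cb db eb] : [/\ c != b, d != b & e != b] by rewrite ![_ == b]eq_sym.
    have [dc ec ed] : [/\ d != c, e != c & e != d] by rewrite ![_ == c]eq_sym [e == d]eq_sym.
    by case: i => [[|[|[|[|[|//]]]]] ?]; rewrite zE /psi /=;
      do ![rewrite ?eqxx ?(negPf ab) ?(negPf ac) ?(negPf ad) ?(negPf ae) ?(negPf bc)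
         ?(negPf bd) ?(negPf be) ?(negPf cd) ?(negPf ce) ?(negPf de)
         ?(negPf ba) ?(negPf ca) ?(negPf da) ?(negPf ea)
         ?(negPf cb) ?(negPf db) ?(negPf eb) ?(negPf dc) ?(negPf ec) ?(negPf ed) /=].
  have [vs _|vs] := boolP (v \in s).
    have lt : index v s < 5 by rewrite -[5]/(size s) index_mem.
    by exists (Ordinal lt); rewrite /psi /= nth_index.
  move: vs; rewrite !inE !negb_or => /and5P[va vc ve vd vb].
  by rewrite zE (negPf va) (negPf vb) (negPf vc) (negPf vd) /= (negPf vb) (negPf vc)
    (negPf vd) (negPf ve) eqxx.
have [S [W [Theta [cS nuS tT iT]]]] := cycle_lex (isT : prime 5) tG tf zG cz.
exists W, Theta; split=> //.
exact: graph_iso_trans iT (lexprod_iso Theta (circulant5_C5 cS nuS)).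
Qed.

Hypothesis npent : ~ pentagon.

(** Suppose e = c. If {f, g} meets {a, d}, the involutions are those of [dswap_klein] or of a
    pentagon. If not, conjugating (b c)(f g) by (b a)(c d) gives (a d)(f g), and {f, g} would
    accompany both {b, c} and {a, d}, although b is in only one of them. *)
Lemma dswap_share_disjoint a b c d e f g :
  dswap b a c d -> dswap b e f g -> a != e -> e != c.
Proof.
move=> D D' ae; apply/eqP=> ec; subst e.
have key f' g' : dswap b c f' g' -> a != f' -> d != f'.
  move=> Y af; apply/eqP=> df; subst f'.
  have [ag|ag] := eqVneq a g'.
    subst g'; apply: (@dswap_klein a b c d); first by rewrite dswapCl.
    by rewrite dswapCr.
  case: npent; exists g', d, c, b, a; split.
  2: by rewrite dswapCl dswapCA dswapCl.
  2: by rewrite dswapCA dswapCr.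
  move: (dswap_distinct D) (dswap_distinct Y); rewrite !uniq4E.
  case/and5P=> ba bc bd _ /andP[ad cd] /and5P[_ _ bg cd' /andP[cg dg]].
  by rewrite /= !inE !negb_or !(eq_sym g') dg cg bg ag [d == c]eq_sym cd [d == b]eq_sym
    bd [d == a]eq_sym ad [c == b]eq_sym bc [c == a]eq_sym ae ba.
have key2 f' g' : dswap b c f' g' -> a != f'.
  move=> Y; apply/eqP=> af; subst f'.
  have [gd|gd] := eqVneq g' d.
    by subst g'; apply: (@dswap_klein a b c d) => //; rewrite dswapCl.
  case: npent; exists g', a, b, c, d; split; last by rewrite dswapCl.
    move: (dswap_distinct D) (dswap_distinct Y); rewrite !uniq4E.
    case/and5P=> ba bc bd _ /andP[ad cd] /and5P[_ _ bg ca /andP[cg ag]].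
    by rewrite /= !inE !negb_or !(eq_sym g') ag bg cg (eq_sym d) gd [a == b]eq_sym ba ae ad bc bd cd.
  by rewrite dswapCA dswapCr.
have af := key2 _ _ D'; have D'' : dswap b c g f by rewrite dswapCr.
have ag := key2 _ _ D''.
have df := key _ _ D' af; have dg := key _ _ D'' ag.
have /= := dswapJ D D'; move: (dswap_distinct D) (dswap_distinct D'); rewrite !uniq4E.
case/and5P=> ba bc bd _ /andP[ad cd] /and5P[_ bf bg cf /andP[cg fg]].
rewrite eqxx [c == b]eq_sym (negPf bc) [c == a]eq_sym (negPf ae) eqxx.
rewrite !(eq_sym f) (negPf bf) (negPf af) (negPf cf) (negPf df).
rewrite !(eq_sym g) (negPf bg) (negPf ag) (negPf cg) (negPf dg).
rewrite dswapCA => E; rewrite dswapCA in D'.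
by have := dswap_pair E D'; rewrite (negPf ba) (negPf bd).
Qed.

(** The conclusion is the conjugate of the second involution by the first, once e and g are known to
    be fixed by the first. *)
Lemma dswap_compose a b d e g k :
  dswap b a d k -> dswap b e k g -> a != e -> dswap a e d g.
Proof.
move=> D D' ae.
have D2 : dswap b a k d by rewrite dswapCr.
have D2' : dswap b e g k by rewrite dswapCr.
have ek := dswap_share_disjoint D2 D' ae; have ed := dswap_share_disjoint D D' ae.
have ea : e != a by rewrite eq_sym.
have ak := dswap_share_disjoint D' D ea; have ag := dswap_share_disjoint D2' D ea.
move: (dswap_distinct D) (dswap_distinct D'); rewrite !uniq4E.
case/and5P=> ba bd bk ad' /andP[ak' dk] /and5P[be _ bg _ /andP[eg kg]].
have gd : g != d.
  apply/eqP=> gd; subst g; rewrite dswapCA in D2; rewrite dswapCA in D'.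
  by have := dswap_pair D2 (_ : dswap k d e b); rewrite dswapCr (eq_sym e) (negPf be) (negPf ea) => /(_ D').
have /= := dswapJ D D'; rewrite eqxx (eq_sym e b) (negPf be) (negPf ea) (negPf ed) (negPf ek).
rewrite (eq_sym k b) (negPf bk) (eq_sym k a) (negPf ak') (eq_sym k d) (negPf dk) eqxx.
by rewrite (eq_sym g b) (negPf bg) (eq_sym g a) (negPf ag) (negPf gd) (eq_sym g k) (negPf kg).
Qed.

(** If {c, d} and {f, g} were disjoint, conjugating each involution by the other would give both (a
    e)(c d) and (a e)(f g), whereas {a, e} determines its companion. So they share a point k, and
    [dswap_compose] applies. *)
Lemma dswap_share a b c d e f g : dswap b a c d -> dswap b e f g -> a != e ->
  exists k c' g', [/\ dswap b a c' k, dswap b e k g' & dswap a e c' g'].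
Proof.
move=> D D' ae.
suff [k [c' [g' [H1 H2]]]] : exists k c' g', dswap b a c' k /\ dswap b e k g'.
  by exists k, c', g'; split=> //; exact: dswap_compose H1 H2 ae.
have Dr : dswap b a d c by rewrite dswapCr.
have Dr' : dswap b e g f by rewrite dswapCr.
have [cf|cf] := eqVneq c f; first by exists c, d, g; rewrite {2}cf.
have [df|df] := eqVneq d f; first by exists d, c, g; rewrite {2}df.
have [cg|cg] := eqVneq c g; first by exists c, d, f; rewrite {2}cg.
have [dg|dg] := eqVneq d g; first by exists d, c, f; rewrite {2}dg.
have ea : e != a by rewrite eq_sym.
have ec := dswap_share_disjoint D D' ae; have ed := dswap_share_disjoint Dr D' ae.
have af := dswap_share_disjoint D' D ea; have ag := dswap_share_disjoint Dr' D ea.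
move: (dswap_distinct D) (dswap_distinct D'); rewrite !uniq4E.
case/and5P=> ba bc bd ac /andP[ad cd] /and5P[be bf bg ef /andP[eg fg]].
have /= := dswapJ D D'; have /= := dswapJ D' D.
rewrite !eqxx (eq_sym e b) (negPf be) (negPf ea) (negPf ec) (negPf ed).
rewrite (eq_sym a b) (negPf ba) (negPf ae) (negPf af) (negPf ag).
rewrite (eq_sym c b) (negPf bc) (eq_sym c e) (negPf ec) (negPf cf) (negPf cg).
rewrite (eq_sym d b) (negPf bd) (eq_sym d e) (negPf ed) (negPf df) (negPf dg).
rewrite !(eq_sym f) (negPf bf) (negPf af) (negPf cf) (negPf df).
rewrite !(eq_sym g) (negPf bg) (negPf ag) (negPf cg) (negPf dg).
by rewrite dswapCl => H1 /(dswap_pair H1); rewrite !(eq_sym f) (negPf cf) (negPf df).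
Qed.

End DoubleSwaps.

(** A permutation moving exactly four points is a double transposition or a 4-cycle, and the square
    of a 4-cycle is a double transposition. *)
Lemma supp4_dswap (V : finType) (G : graph V) (x : {perm V}) :
  x \in gaut G -> #|supp x| = 4 -> exists a b c d, dswap G a b c d.
Proof.
move=> xG sx.
have sE a b c d : uniq [:: a; b; c; d] -> x a != a -> x b != b -> x c != c -> x d != d ->
    forall v, x v != v -> [|| v == a, v == b, v == c | v == d].
  move=> U xa xb xc xd v xv; have : v \in supp x by rewrite inE.
  suff -> : supp x = [set v in [:: a; b; c; d]] by rewrite !inE.
  apply/esym/eqP; rewrite eqEcard sx cardsE (card_uniqP U) leqnn andbT.
  by apply/subsetP=> w; rewrite !inE => /or4P[] /eqP ->.
have moved_x v : x v != v -> x (x v) != x v by rewrite (inj_eq perm_inj).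
have [a] : exists a, a \in supp x by apply/card_gt0P; rewrite sx.
rewrite inE => xa; pose b := x a.
have ab : a != b by rewrite eq_sym.
have xb : x b != b by exact: moved_x.
have [xba|xba] := eqVneq (x b) a.
  have [c /setDP[]] : exists c, c \in supp x :\: [set a; b].
    apply/set0Pn; rewrite -card_gt0 cardsD subn_gt0 sx.
    by apply: (@leq_ltn_trans 2); rewrite // (leq_trans (subset_leq_card (subsetIr _ _))) // cards2; case: (_ != _).
  rewrite !inE negb_or => xc /andP[ca cb]; pose d := x c.
  have xd : x d != d by exact: moved_x.
  have U : uniq [:: a; b; c; d].
    rewrite uniq4E ab [a == c]eq_sym ca [b == c]eq_sym cb [c == d]eq_sym xc.
    by rewrite {1}(_ : a = x b) // (inj_eq perm_inj) eq_sym cb /b (inj_eq perm_inj) eq_sym ca.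
  have xdc : x d = c.
    have := sE _ _ _ _ U xa xb xc xd (x d) (moved_x _ xd).
    move: U; rewrite uniq4E => /and5P[_ _ ad _ /andP[bd _]].
    have xda : x d != a by rewrite -xba (inj_eq perm_inj) eq_sym.
    have xdb : x d != b by rewrite (inj_eq perm_inj) eq_sym.
    by rewrite (negPf xd) (negPf xda) (negPf xdb) orbF => /eqP.
  exists a, b, c, d; rewrite /dswap U /=.
  suff -> : (tperm a b * tperm c d)%g = x by [].
  apply/permP=> v; rewrite tperm2E //.
  case: (eqVneq v a) => [->//|va]; case: (eqVneq v b) => [->//|vb].
  case: (eqVneq v c) => [->//|vc]; case: (eqVneq v d) => [->//|vd].
  apply/esym/eqP; apply: contraT => /(sE _ _ _ _ U xa xb xc xd).
  by rewrite (negPf va) (negPf vb) (negPf vc) (negPf vd).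
pose c := x b; have xc : x c != c by exact: moved_x.
pose d := x c; have xd : x d != d by exact: moved_x.
have bc : b != c by rewrite eq_sym.
have cd : c != d by rewrite eq_sym.
have ac : a != c by rewrite eq_sym.
have bd : b != d by rewrite /b /d (inj_eq perm_inj).
have ad : a != d.
  (* A 3-cycle on a, b, c would leave the fourth moved point without an image. *)
  apply/eqP=> ad.
  have [e] : exists e, e \in supp x :\: [set a; b; c].
    apply/set0Pn; rewrite -card_gt0 cardsD subn_gt0 sx.
    apply: (@leq_ltn_trans 3); rewrite // (leq_trans (subset_leq_card (subsetIr _ _))) //.
    by rewrite -setUA cardsU1 cards2; case: (_ \notin _); case: (_ != _).
  rewrite !inE !negb_or => /andP[/andP[/andP[ea eb] ec] xe].
  have U : uniq [:: a; b; c; e].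
    by rewrite uniq4E ab ac bc /= ![_ == e]eq_sym ea eb ec.
  have := sE _ _ _ _ U xa xb xc xe (x e) (moved_x _ xe).
  have xea : x e != a by rewrite ad (inj_eq perm_inj).
  have xeb : x e != b by rewrite (inj_eq perm_inj).
  have xec : x e != c by rewrite (inj_eq perm_inj).
  by rewrite (negPf xe) (negPf xea) (negPf xeb) (negPf xec).
have U : uniq [:: a; b; c; d] by rewrite uniq4E ab ac ad bc bd cd.
have xda : x d = a.
  have := sE _ _ _ _ U xa xb xc xd (x d) (moved_x _ xd).
  have xdb : x d != b by rewrite (inj_eq perm_inj) eq_sym.
  have xdc : x d != c by rewrite (inj_eq perm_inj) eq_sym.
  by rewrite (negPf xd) (negPf xdb) (negPf xdc) !orbF => /eqP.
exists a, c, b, d; have U' : uniq [:: a; c; b; d].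
  by rewrite uniq4E ab ac ad bd cd [c == b]eq_sym bc.
rewrite /dswap U' /=; suff -> : (tperm a c * tperm b d)%g = (x * x)%g by rewrite groupM.
apply/permP=> v; rewrite tperm2E // permM.
case: (eqVneq v a) => [->//|va].
case: (eqVneq v c) => [->|vc]; first by rewrite -/d xda.
case: (eqVneq v b) => [->//|vb].
case: (eqVneq v d) => [->|vd]; first by rewrite xda.
have xv : x v = v.
  apply/eqP; apply: contraT => /(sE _ _ _ _ U xa xb xc xd).
  by rewrite (negPf va) (negPf vb) (negPf vc) (negPf vd).
by rewrite !xv.
Qed.

(** * Rows and opposite rows *)

Section Inflation.
Variables (V : finType) (G : graph V).
Hypotheses (tf : twin_free G) (npent : ~ pentagon G).
Implicit Types (a b c d e f g k u v : V).

(** The names refer to the inflation to be built: classes of [row_mate] become the fibres over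
    Sigma, and [opposite] relates the two fibres over a block. *)
Definition row_mate a b : bool := (a == b) || [exists c, exists d, dswap G a b c d].

Definition opposite a v : bool := [exists b, exists d, dswap G a b v d].

Lemma row_mateP a b :
  reflect (a = b \/ exists c d, dswap G a b c d) (row_mate a b).
Proof.
apply: (iffP orP) => [[/eqP|/existsP[c /existsP[d D]]]|[/eqP|[c [d D]]]];
  [by left | by right; exists c, d | by left | right].
by apply/existsP; exists c; apply/existsP; exists d.
Qed.

Lemma oppositeP a v : reflect (exists b d, dswap G a b v d) (opposite a v).
Proof.
apply: (iffP existsP) => [[b /existsP[d D]]|[b [d D]]]; exists b; first by exists d.
by apply/existsP; exists d.
Qed.

Lemma row_mate_refl a : row_mate a a.
Proof. by rewrite /row_mate eqxx. Qed.

Lemma row_mate_sym a b : row_mate a b = row_mate b a.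
Proof.
by apply/row_mateP/row_mateP=> -[->|[c [d D]]]; [left | right | left | right] => //;
  exists c, d; rewrite dswapCl.
Qed.

Lemma row_mate_trans a b c : row_mate a b -> row_mate b c -> row_mate a c.
Proof.
move=> /row_mateP[->//|[p [q D]]] /row_mateP[<-|[r [s D']]]; apply/row_mateP.
  by right; exists p, q.
have [->|ac] := eqVneq a c; first by left.
rewrite dswapCl in D.
by have [k [c' [g' [_ _ H]]]] := dswap_share tf npent D D' ac; right; exists c', g'.
Qed.

Lemma opposite_sym a v : opposite a v = opposite v a.
Proof.
by apply/oppositeP/oppositeP=> -[b [d D]]; exists d, b; rewrite dswapCA.
Qed.

Lemma dswap_row_mate a b c d : dswap G a b c d -> row_mate a b.
Proof. by move=> D; apply/row_mateP; right; exists c, d. Qed.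

Lemma dswap_opposite a b c d : dswap G a b c d -> opposite a c.
Proof. by move=> D; apply/oppositeP; exists b, d. Qed.

(** When b and b1 differ, [dswap_share] gives (a b)(c' k), (a b1)(k g') and (b b1)(c' g'). As v is k
    or g', the first or the third shows that it is opposite to b. *)
Lemma opposite_row_matel a b v : row_mate a b -> opposite a v -> opposite b v.
Proof.
move=> /row_mateP[->//|[p [q D]]] /oppositeP[b1 [d1 D1]].
have [bb|bb] := eqVneq b b1.
  by subst b1; rewrite dswapCl in D1; apply: dswap_opposite D1.
have [k [c' [g' [H1 H2 H3]]]] := dswap_share tf npent D D1 bb.
have := dswap_pair tf H2 D1; case/orP=> /eqP ->.
  by rewrite dswapCl dswapCr in H1; apply: dswap_opposite H1.
by rewrite dswapCr in H3; apply: dswap_opposite H3.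
Qed.

Lemma opposite_row_mate a b u v : row_mate a b -> row_mate u v ->
  opposite a u = opposite b v.
Proof.
move=> ab uv; apply/idP/idP=> H.
  move: (opposite_row_matel ab H); rewrite opposite_sym => /(opposite_row_matel uv).
  by rewrite opposite_sym.
rewrite row_mate_sym in ab; rewrite row_mate_sym in uv.
move: (opposite_row_matel ab H); rewrite opposite_sym => /(opposite_row_matel uv).
by rewrite opposite_sym.
Qed.

(** The pairs that contain u and v coincide or share a point k, and k is then a row mate of both. *)
Lemma opposite_unique a u v : opposite a u -> opposite a v -> row_mate u v.
Proof.
move=> /oppositeP[b [d D]] /oppositeP[b1 [d1 D1]].
have pairR b' c' d' w : dswap G a b' c' d' -> (w == c') || (w == d') -> row_mate c' w.
  move=> D2 /orP[] /eqP ->; first exact: row_mate_refl.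
  by rewrite dswapCA in D2; apply: dswap_row_mate D2.
have [bb|bb] := eqVneq b b1.
  by subst b1; apply: (pairR _ _ _ _ D); apply: (dswap_pair tf D D1).
have [k [c' [g' [H1 H2 _]]]] := dswap_share tf npent D D1 bb.
have c'u := pairR _ _ _ _ H1 (dswap_pair tf H1 D).
have kv := pairR _ _ _ _ H2 (dswap_pair tf H2 D1).
apply: (@row_mate_trans _ k); last exact: kv.
rewrite row_mate_sym in c'u; apply: row_mate_trans c'u _.
by apply: (pairR _ _ _ _ H1); rewrite eqxx orbT.
Qed.

Lemma opposite_irr a v : opposite a v -> ~~ row_mate a v.
Proof.
move=> /oppositeP[b [d D]]; move: (dswap_distinct D); rewrite uniq4E.
case/and5P=> ab av ad bv _; apply/row_mateP=> -[/eqP|[p [q D']]]; first by rewrite (negPf av).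
by have := dswap_share_disjoint tf npent D D' bv; rewrite eqxx.
Qed.

Lemma row_mate_edge a b v : row_mate a b -> v != a -> v != b ->
  ~~ opposite a v -> G v a = G v b.
Proof.
move=> /row_mateP[->//|[c [d D]]] va vb nv; apply/eqP; apply: contraNT nv.
rewrite (dswap_moved tf D va vb) => /orP[] /eqP ->; first exact: dswap_opposite D.
by rewrite dswapCr in D; apply: dswap_opposite D.
Qed.

(* The partners of [a] form a star: the sets [{c, d}] with [(a b)(c d)] an
   automorphism meet pairwise and each is split by the neighbourhood of [a],
   so no three of them form a triangle. *)
Lemma opposite_center a u : opposite a u ->
  exists c, opposite a c /\ forall v, opposite a v -> v != c -> G a v != G a c.
Proof.
move=> /oppositeP[b [d D]]; move: u D => c D.
have star k : opposite a k ->
    (forall b' c' d', dswap G a b' c' d' -> (k == c') || (k == d')) ->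
    exists c, opposite a c /\ forall v, opposite a v -> v != c -> G a v != G a c.
  move=> ak H; exists k; split=> // v /oppositeP[b' [d' D']] vk.
  have := H _ _ _ D'; rewrite eq_sym (negPf vk) => /eqP ->.
  exact: dswap_neq D'.
(* [P k] puts k in every pair accompanying a. It is boolean, so its failure produces a pair that
   misses k. *)
pose P k := [forall b', forall c', forall d', dswap G a b' c' d' ==> (k == c') || (k == d')].
have PP k : P k -> forall b' c' d', dswap G a b' c' d' -> (k == c') || (k == d').
  by move=> /forallP H b' c' d'; move: (H b') => /forallP/(_ c')/forallP/(_ d')/implyP.
have nPP k : ~~ P k -> exists b' c' d', dswap G a b' c' d' /\ ~~ ((k == c') || (k == d')).
  case/forallPn=> b' /forallPn[c' /forallPn[d']]; rewrite negb_imply => /andP[? ?].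
  by exists b', c', d'.
have [/PP Pc|/nPP[b1 [c1 [d1 [D1 n1]]]]] := boolP (P c).
  by apply: star Pc; apply: dswap_opposite D.
have [/PP Pd|/nPP[b2 [c2 [d2 [D2 n2]]]]] := boolP (P d).
  by apply: star Pd; rewrite dswapCr in D; apply: dswap_opposite D.
have pairE b' c' d' c'' d'' w : dswap G a b' c' d' -> dswap G a b' c'' d'' ->
    ((w == c') || (w == d')) = ((w == c'') || (w == d'')).
  have sub p q p' q' : dswap G a b' p q -> dswap G a b' p' q' ->
      (w == p') || (w == q') -> (w == p) || (w == q).
    move=> E E' /orP[] /eqP ->; first exact: (dswap_pair tf E E').
    by rewrite dswapCr in E'; apply: (dswap_pair tf E E').
  by move=> E E'; apply/idP/idP; apply: sub.
have ne b' c' d' k : (k == c) || (k == d) -> dswap G a b' c' d' ->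
    ~~ ((k == c') || (k == d')) -> b != b'.
  by move=> kcd E; apply: contraNneq => bb; subst b'; rewrite -(pairE _ _ _ _ _ _ D E).
(* The pair of b1 misses c but meets {c, d}, so it contains d; likewise the pair of b2 contains
   c. *)
have [g1 E1] : exists g1, dswap G a b1 d g1.
  have bb : b != b1 by apply: (ne _ _ _ c _ D1 n1); rewrite eqxx.
  have [k [c' [g' [H1 H2 _]]]] := dswap_share tf npent D D1 bb.
  have : (k == c) || (k == d) by rewrite -(pairE _ _ _ _ _ _ H1 D) eqxx orbT.
  case/orP=> /eqP kE; subst k; last by exists g'.
  by case/negP: n1; rewrite -(pairE _ _ _ _ _ _ H2 D1) eqxx.
have [g2 E2] : exists g2, dswap G a b2 c g2.
  have bb : b != b2 by apply: (ne _ _ _ d _ D2 n2); rewrite eqxx orbT.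
  have [k [c' [g' [H1 H2 _]]]] := dswap_share tf npent D D2 bb.
  have : (k == c) || (k == d) by rewrite -(pairE _ _ _ _ _ _ H1 D) eqxx orbT.
  case/orP=> /eqP kE; subst k; first by exists g'.
  by case/negP: n2; rewrite -(pairE _ _ _ _ _ _ H2 D2) eqxx.
rewrite -(pairE _ _ _ _ _ _ E1 D1) negb_or in n1.
rewrite -(pairE _ _ _ _ _ _ E2 D2) negb_or in n2.
have bb : b1 != b2.
  apply/eqP=> bb; subst b2; move: n1.
  by rewrite -negb_or (pairE _ _ _ _ _ c E1 E2) eqxx.
have [k [c' [g' [H1 H2 _]]]] := dswap_share tf npent E1 E2 bb.
have k1 : (k == d) || (k == g1) by rewrite -(pairE _ _ _ _ _ _ H1 E1) eqxx orbT.
have k2 : (k == c) || (k == g2) by rewrite -(pairE _ _ _ _ _ _ H2 E2) eqxx.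
case/andP: n1 n2 => cd cg1 /andP[dc dg2].
have kd : k != d.
  by apply: contraTneq k2 => ->; rewrite (negPf dc) (negPf dg2).
have kc : k != c.
  by apply: contraTneq k1 => ->; rewrite (negPf cd) (negPf cg1).
rewrite (negPf kd) /= in k1; rewrite (negPf kc) /= in k2.
move/eqP: k1 => k1; move/eqP: k2 => k2.
have := dswap_neq tf D; have := dswap_neq tf E1; have := dswap_neq tf E2.
by rewrite -k1 -k2; case: (G a k) (G a c) (G a d) => [] [] [].
Qed.

Lemma row_mate_gaut (x : {perm V}) a b : x \in gaut G ->
  row_mate (x a) (x b) = row_mate a b.
Proof.
move=> xG; rewrite /row_mate (inj_eq perm_inj); congr (_ || _).
apply/existsP/existsP=> -[c /existsP[d D]].
  exists (x^-1 c)%g; apply/existsP; exists (x^-1 d)%g.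
  by rewrite -(dswap_gaut _ _ _ _ xG) !permKV.
by exists (x c); apply/existsP; exists (x d); rewrite dswap_gaut.
Qed.

Lemma opposite_gaut (x : {perm V}) a b : x \in gaut G ->
  opposite (x a) (x b) = opposite a b.
Proof.
move=> xG; apply/existsP/existsP=> -[c /existsP[d D]].
  exists (x^-1 c)%g; apply/existsP; exists (x^-1 d)%g.
  by rewrite -(dswap_gaut _ _ _ _ xG) !permKV.
by exists (x c); apply/existsP; exists (x d); rewrite dswap_gaut.
Qed.

End Inflation.

(** * Recognising inflations *)

Lemma involution_pair_partition (W : finType) (pr : W -> W) :
    involutive pr -> (forall w, pr w != w) ->
  exists P : pair_partition W, forall w w', ([set w; w'] \in blocks P) = (w' == pr w).
Proof.
move=> prK prn; pose B := [set [set w; pr w] | w in W].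
have B2 w u : (u \in [set w; pr w]) -> [set w; pr w] = [set u; pr u].
  by rewrite !inE => /orP[] /eqP -> //; rewrite prK setUC.
have Bp : partition B [set: W].
  apply/and3P; split.
  - rewrite eqEsubset subsetT; apply/subsetP=> w _; apply/bigcupP.
    by exists [set w; pr w]; [apply: imset_f | rewrite !inE eqxx].
  - apply/trivIsetP=> X Y /imsetP[w _ ->] /imsetP[w' _ ->]; apply: contraNT.
    rewrite -setI_eq0 => /set0Pn[u /setIP[/B2 -> /B2 ->]].
    by rewrite eqxx.
  by apply/imsetP=> -[w _ /setP/(_ w)]; rewrite !inE eqxx.
have Bc X : X \in B -> #|X| = 2.
  by case/imsetP=> w _ ->; rewrite cards2 eq_sym prn.
exists (PairPartition Bp Bc) => w w'; apply/imsetP/eqP => [[u _ E]|->]; last by exists w.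
have wu : w \in [set u; pr u] by rewrite -E !inE eqxx.
have : #|[set w; w']| = 2 by rewrite E cards2 eq_sym prn.
rewrite cards2; have [->//|ww _] := eqVneq w w'.
have : w' \in [set w; pr w] by rewrite -(B2 u w wu) -E !inE eqxx orbT.
by rewrite !inE eq_sym (negPf ww) => /eqP.
Qed.

Section InflationForm.
Variables (V : finType) (G : graph V).
Hypotheses (tG : vertex_transitive G) (tf : twin_free G) (npent : ~ pentagon G).

Lemma dswap_Inf a0 b0 c0 d0 : dswap G a0 b0 c0 d0 ->
  exists (m : nat) (lambda kappa : bool) (W : finType)
         (S : graph W) (P : pair_partition W),
    [/\ 2 <= m,
        [transitive gaut_part S P, on [set: W] | 'P],
        ~ (lambda <> kappa /\ has_block_transposition S P)
      & graph_iso G (Inf S P m lambda kappa)].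
Proof.
move=> D0; have trans := gaut_trans tG.
pose R := row_mate G; pose N := opposite G.
have Rrefl a : R a a by exact: row_mate_refl.
have Rsym a b : R a b = R b a by exact: row_mate_sym.
have Rtr b a c : R a b -> R b c -> R a c by exact: row_mate_trans.
have Nsym a b : N a b = N b a by exact: opposite_sym.
have NR a b u v : R a b -> R u v -> N a u = N b v by exact: opposite_row_mate.
have [c [Nc cC]] := opposite_center tf npent (dswap_opposite D0).
pose lambda := G a0 c.
(* [tau a] is the vertex with the same index as a in the opposite row: the only one opposite to a
   whose adjacency to a is [lambda]. Transitivity carries the value found at a0 to every vertex, and
   since the characterization is symmetric, [tau] is an involution. *)
have [tau tauP] : exists tau : V -> V, forall a, [/\ N a (tau a), G a (tau a) = lambda
    & forall v, N a v -> v != tau a -> G a v = ~~ lambda].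
  have tau_ex a : exists t, [&& N a t, G a t == lambda &
      [forall v, N a v ==> (v != t) ==> (G a v == ~~ lambda)]].
    have [g gG <-] := trans a0 a; exists (g c).
    rewrite /N opposite_gaut // Nc; move/gautP: (gG) => ->; rewrite eqxx /=.
    apply/forallP=> v; apply/implyP=> av; apply/implyP=> vc.
    have := cC (g^-1 v)%g; rewrite -(opposite_gaut _ _ gG) permKV => /(_ av).
    have -> : g^-1%g v != c by apply: contraNneq vc => <-; rewrite permKV.
    move/(_ isT); move/gautP: gG => <-; rewrite permKV -/lambda.
    by case: (G _ _) (lambda) => -[].
  exists (fun a => xchoose (tau_ex a)) => a.
  have /and3P[? /eqP ? /forallP H] := xchooseP (tau_ex a); split=> // v av vt.
  by move: (H v); rewrite av vt => /eqP.
have Nt a : N a (tau a) by have [] := tauP a.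
have Gt a : G a (tau a) = lambda by have [] := tauP a.
have tau_edge a v : N a v -> (G a v == lambda) = (v == tau a).
  move=> av; have [_ _ H] := tauP a; have [->|vt] := eqVneq v (tau a).
    by rewrite Gt eqxx.
  by rewrite H //; case: (lambda).
have tauK : involutive tau.
  move=> a; apply/esym/eqP; rewrite -tau_edge; last by rewrite Nsym.
  by rewrite edge_sym Gt.
have tauR u v : R u v -> R (tau u) (tau v).
  by move=> uv; apply: (opposite_unique tf npent (Nt u)); rewrite -/N (NR _ v _ (tau v)).
pose cl v := [set u | R v u].
have clP u v : cl u = cl v <-> R u v.
  split=> [/setP/(_ v)|uv]; first by rewrite !inE Rrefl.
  apply/setP=> w; rewrite !inE; apply/idP/idP; last exact: Rtr.
  by apply: Rtr; rewrite Rsym.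
have [W [pi [s [piK piE']]]] := quotient_type cl.
have piP u v : reflect (pi u = pi v) (R u v).
  by apply: (iffP idP) => [/clP/piE'|/piE'/clP].
have piS u : R u (s (pi u)) by apply/piP; rewrite piK.
pose pr w := pi (tau (s w)).
have prE u : pr (pi u) = pi (tau u) by apply/esym/piP/tauR/piS.
have prK : involutive pr by move=> w; rewrite /pr -/(pr _) prE tauK piK.
have NE u v : N u v = (pi v == pr (pi u)).
  rewrite prE; apply/idP/eqP => [uv|/piP uv]; last first.
    by rewrite (NR u u v (tau u)).
  by apply/piP/(opposite_unique tf npent uv)/Nt.
have prn w : pr w != w.
  apply/eqP=> E; have : N (s w) (s w) by rewrite NE piK E.
  by move/(opposite_irr tf npent); rewrite row_mate_refl.
have prC w w' : (w == pr w') = (w' == pr w).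
  by rewrite -(inj_eq (inv_inj prK)) prK eq_sym.
have [P PE] := involution_pair_partition prK prn.
(* [Inf] does not read the edges of Sigma inside blocks, so none are put there; off the blocks,
   adjacency of rows is well defined. *)
pose sr (w w' : W) := [&& w != w', w' != pr w & G (s w) (s w')].
have sr_sym : symmetric sr.
  by move=> w w'; rewrite /sr eq_sym edge_sym prC.
have sr_irr : irreflexive sr by move=> w; rewrite /sr eqxx.
pose S := Graph sr_sym sr_irr.
have GR u u' v : R u u' -> ~~ R u v -> ~~ N u v -> G v u = G v u'.
  move=> uu' uv; apply: row_mate_edge => //.
    by apply: contraNneq uv => ->.
  by apply: contraNneq uv => ->.
have SE u v : pi u != pi v -> pi v != pr (pi u) -> S (pi u) (pi v) = G u v.
  move=> uv uv'; rewrite /= /sr uv uv' /=.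
  have nR a b : pi a = pi u -> pi b = pi v -> ~~ R a b.
    by move=> au bv; apply: contraNN uv => /piP; rewrite au bv => ->.
  have nN a b : pi a = pi u -> pi b = pi v -> ~~ N a b.
    by move=> au bv; rewrite NE au bv.
  rewrite edge_sym -(GR u) ?nR ?nN ?piK // edge_sym.
  by rewrite -(GR v) // 1?Rsym 1?Nsym ?nR ?nN ?piK // Rsym.
have [psi [psiI psiP]] := class_labelling cl a0; set m := #|_| in psi psiI psiP.
have m2 : 2 <= m.
  apply/card_gt1P; exists a0, b0; rewrite !inE eqxx; split=> //.
    by apply/eqP/clP; rewrite Rsym; apply: dswap_row_mate D0.
  by move: (dswap_distinct D0); rewrite uniq4E => /andP[].
have psi0 i : R a0 (psi i) by apply/clP/esym/psiP; exists i.
have [kappa kU] : exists kappa, uniform (induced psi G) kappa.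
  apply: uniform_of_stars => i j k ij ik /=; rewrite -(inj_eq psiI) in ij.
  rewrite -(inj_eq psiI) in ik; apply: row_mate_edge => //.
    by apply: Rtr (psi0 k); rewrite Rsym.
  apply/negP=> /(opposite_irr tf npent)/negP[].
  by apply: Rtr (psi0 i); rewrite Rsym.
have kappaE u v : R u v -> u != v -> G u v = kappa.
  have [g gG <-] := trans a0 u; rewrite -(permKV g v) /R row_mate_gaut // (inj_eq perm_inj).
  move/gautP: (gG) => ->; move: (g^-1%g v) => {}v a0v nv.
  have /psiP[i iE] : cl a0 = cl a0 by [].
  have /psiP[j jE] : cl v = cl a0 by apply/esym/clP.
  rewrite iE jE; apply: kU; apply: contraNneq nv => ij.
  by rewrite jE -ij -iE.
have [gg ggP] : exists gg : W -> {perm V}, forall w, (gg w \in gaut G) && (gg w a0 == s w).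
  apply: (@fin_all_exists _ _ (fun w (g : {perm V}) => (g \in gaut G) && (g a0 == s w))) => w.
  by have [g gG ga] := trans a0 (s w); exists g; rewrite gG ga eqxx.
have ggG w : gg w \in gaut G by case/andP: (ggP w).
have gg0 w : gg w a0 = s w by apply/eqP; case/andP: (ggP w).
pose F0 w i := gg w (psi i).
have F0pi w i : pi (F0 w i) = w.
  by rewrite -[RHS]piK -gg0; apply/esym/piP; rewrite /R row_mate_gaut.
have F0I w : injective (F0 w) by move=> i j /perm_inj/psiI.
have F0s v : exists i, v = F0 (pi v) i.
  have /psiP[i iE] : cl ((gg (pi v))^-1%g v) = cl a0.
    apply/clP; rewrite /R -(row_mate_gaut _ _ (ggG (pi v))) permKV gg0.
    exact: piS.
  by exists i; rewrite /F0 -iE permKV.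
(* Labels are transported from the class of [a0] to one class of each pair,
   and carried to its partner by [tau]. *)
pose lead w := enum_rank w < enum_rank (pr w).
have leadN w : lead (pr w) = ~~ lead w.
  rewrite /lead prK -leqNgt ltn_neqAle andb_idl // => _.
  by apply: contra (prn w) => /eqP/val_inj/enum_rank_inj ->.
pose F (u : W * 'I_m) := if lead u.1 then F0 u.1 u.2 else tau (F0 (pr u.1) u.2).
have Fpi w i : pi (F (w, i)) = w.
  by rewrite /F /=; case: ifP => _; rewrite ?F0pi // -prE F0pi prK.
have Ftau w i : tau (F (w, i)) = F (pr w, i).
  by rewrite /F /= leadN; case: (lead w); rewrite /= ?prK ?tauK.
have FI w : injective (fun i => F (w, i)).
  move=> i j; rewrite /F /=; case: ifP => _; first exact: F0I.
  by move/(can_inj tauK)/F0I.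
exists m, lambda, kappa, W, S, P; split=> //.
- apply: (@transitive_perm _ _ (pi a0)) => w; have gG := ggG w; set g := gg w in gG.
  have [|h hE] := @quotient_perm _ _ pi s g piK.
    by move=> u v; split=> /piP uv; apply/piP; rewrite /R row_mate_gaut in uv *.
  have hpr v : h (pr v) = pr (h v).
    rewrite -(piK v) prE !hE prE; apply/piP/(opposite_unique tf npent _ (Nt _)).
    by rewrite opposite_gaut.
  exists h; last by rewrite hE /g gg0 piK.
  rewrite inE; apply/andP; split; last first.
    apply/forallP=> a; apply/forallP=> b.
    by rewrite !PE -hpr (inj_eq perm_inj).
  apply/gautP=> a b; have [<-|ab] := eqVneq a b; first by rewrite !edge_irr.
  have [bE|ab'] := eqVneq b (pr a).
    by rewrite bE hpr /= /sr !eqxx !andbF.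
  rewrite -(piK a) -(piK b) in ab ab' *; rewrite [in RHS]SE // !hE SE.
  + by move/gautP: gG => ->.
  + by rewrite -!hE (inj_eq perm_inj).
  by rewrite -!hE -hpr (inj_eq perm_inj).
- case=> lk [a [b [+ tab]]]; rewrite PE => /eqP bE; subst b.
  have kl : kappa = ~~ lambda by case: (kappa) (lambda) lk => [] [] // [].
  pose u := s a; have piu : pi u = a by rewrite piK.
  have pitu : pi (tau u) = pr a by rewrite -prE piu.
  (* With [kappa] the negation of [lambda], each vertex of the two rows other than u and [tau u] is
     joined to both with the value [kappa]. The block transposition settles the remaining rows. *)
  suff /tf E : twins G u (tau u) by have := prn a; rewrite -pitu -E piu eqxx.
  apply/twinsP=> v vu vtu; have [va|va] := eqVneq (pi v) a.
    have Rvu : R v u by apply/piP; rewrite va.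
    rewrite kappaE // kl; have [_ _ H] := tauP (tau u); rewrite edge_sym H //.
      by rewrite NE va pitu prK.
    by rewrite tauK.
  have [vb|vb] := eqVneq (pi v) (pr a).
    have [_ _ H] := tauP u; rewrite edge_sym H // -?kl; last by rewrite NE vb piu.
    by rewrite kappaE //; apply/piP; rewrite vb pitu.
  move: tab; rewrite tperm_gaut => /twinsP/(_ (pi v) va vb).
  have -> : S (pi v) a = G v u by rewrite -[in LHS]piu SE ?piu // prC.
  suff -> : S (pi v) (pr a) = G v (tau u) by [].
  by rewrite -[in LHS]pitu SE ?pitu // (inj_eq (inv_inj prK)) eq_sym.
apply: (@graph_iso_inv _ _ _ _ F).
  have Finj : injective F.
    move=> [w i] [w' j] E; have := Fpi w i; rewrite E Fpi => ww; subst w'.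
    by move/FI: E => ->.
  have Fs v : exists u, F u == v.
    case lv : (lead (pi v)).
      have [i iE] := F0s v; exists (pi v, i).
      by rewrite /F /= lv -iE.
    have [i iE] := F0s (tau v); exists (pi v, i).
    by rewrite /F /= lv prE -iE tauK.
  exists (fun v => xchoose (Fs v)) => [u|v]; last exact/eqP/(xchooseP (Fs v)).
  exact/Finj/eqP/(xchooseP (Fs (F u))).
move=> [w i] [w' j]; rewrite [RHS]/= /Inf_rel /= !PE.
have [ww|ww] := eqVneq w w'.
  subst w'; rewrite eq_sym (negPf (prn w)) /= /sr eqxx /=.
  have [->|ij] := eqVneq i j; first by rewrite edge_irr.
  rewrite kappaE ?(inj_eq (FI w)) //; first by case: kappa {kU kappaE}.
  by apply/piP; rewrite !Fpi.
have [w'E|ww'] := eqVneq w' (pr w).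
  subst w'; rewrite /= orbF.
  (* Since F commutes with [tau], the indices agree exactly when the second vertex is [tau] of the
     first, that is, when their adjacency is [lambda]. *)
  have NF : N (F (w, i)) (F (pr w, j)) by rewrite NE !Fpi.
  have := tau_edge _ _ NF; rewrite Ftau (inj_eq (FI (pr w))) [j == i]eq_sym.
  by case: (G _ _) (lambda) (i == j) => [] [] [].
rewrite /= !orbF -[LHS]SE ?Fpi //.
Qed.

End InflationForm.

(** Theta[K_m box K_2] is itself an inflation of Theta[2K_1], with [lambda] = [kappa] = 1, and its
    variant with the complement has [lambda] = [kappa] = 0. It thus suffices to tell pentagons from
    inflations. *)
Lemma motion4_forms (V : finType) (G : graph V) :
  vertex_transitive G -> motion G = 4 ->
  [\/ exists (W : finType) (Theta : graph W),
        vertex_transitive Theta /\ graph_iso G (lexprod Theta C5),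
      exists (m : nat) (W : finType) (Theta : graph W),
        [/\ 3 <= m, vertex_transitive Theta
          & graph_iso G (lexprod Theta (cartprod (complete m) (complete 2)))
            \/ graph_iso G
                 (lexprod Theta
                    (complement (cartprod (complete m) (complete 2))))]
    | exists (m : nat) (lambda kappa : bool) (W : finType)
             (S : graph W) (P : pair_partition W),
        [/\ 2 <= m,
            [transitive gaut_part S P, on [set: W] | 'P],
            ~ (lambda <> kappa /\ has_block_transposition S P)
          & graph_iso G (Inf S P m lambda kappa)]].
Proof.
move=> tG m4; have tf := motion4_twin_free m4.
have [|x xG [x1 sx]] := @motion_exists _ G; first by rewrite m4.
rewrite m4 in sx; have [a [b [c [d D]]]] := supp4_dswap xG sx.
(* A boolean form of [pentagon], which makes the case distinction decidable. *)
pose pentb := [exists a, exists b, exists c, exists d, exists e,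
  [&& uniq [:: a; b; c; d; e], dswap G a b c d & dswap G b c d e]].
have [pent|npent] := boolP pentb.
  constructor 1; apply: pentagon_C5 => //.
  case/existsP: pent => p /existsP[q /existsP[r /existsP[s /existsP[t /and3P[? ? ?]]]]].
  by exists p, q, r, s, t.
constructor 3; apply: dswap_Inf D => // -[p [q [r [s [t [U D1 D2]]]]]].
case/negP: npent; apply/existsP; exists p; apply/existsP; exists q.
apply/existsP; exists r; apply/existsP; exists s; apply/existsP; exists t.
by rewrite U D1.
Qed.

(** * Graphs of motion four *)

Lemma supp4_motion (V : finType) (G : graph V) (x : {perm V}) :
  twin_free G -> x \in gaut G -> #|supp x| = 4 -> motion G = 4.
Proof.
move=> tf xG sx; apply: motionP; last by move=> y; exact: twin_free_supp.
exists x => //; split=> //; apply/eqP=> x1.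
by move: sx; rewrite x1 supp1 cards0.
Qed.

Lemma lex_motion4 (U W : finType) (Delta : graph U) (Theta : graph W) (x : {perm U}) :
    W -> twin_free Delta -> (forall i e, exists2 j, j != i & Delta i j != e) ->
    x \in gaut Delta -> #|supp x| = 4 ->
  motion (lexprod Theta Delta) = 4.
Proof.
move=> w tf nd xD sx; have [y [yL _ sy]] := lex_fibre_aut Theta w xD.
apply: (supp4_motion _ yL); first exact: lex_twin_free.
by rewrite sy card_imset // => i j [].
Qed.

Section Complement.
Variables (V : finType) (G : graph V).

Lemma complementE a b : a != b -> complement G a b = ~~ G a b.
Proof. by rewrite /= /complement_rel => ->. Qed.

Lemma complement_gaut x : x \in gaut G -> x \in gaut (complement G).
Proof.
move=> /gautP xG; apply/gautP=> a b.
by rewrite /= /complement_rel (inj_eq perm_inj) xG.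
Qed.

Lemma complement_twin_free : twin_free G -> twin_free (complement G).
Proof.
move=> tf a b /twinsP t; apply: tf; apply/twinsP=> v va vb.
by apply/negb_inj; rewrite -!complementE // t.
Qed.

Lemma complement_mixed : (forall i e, exists2 j, j != i & G i j != e) ->
  forall i e, exists2 j, j != i & complement G i j != e.
Proof.
move=> nd i e; have [j ji Gij] := nd i (~~ e); exists j => //.
by rewrite complementE 1?eq_sym //; case: (G i j) e Gij => -[].
Qed.

End Complement.

Lemma ord_third m (i j : 'I_m) : 2 < m -> exists2 k, k != i & k != j.
Proof.
move=> m3; have [k] : exists k, k \in ~: [set i; j].
  apply/card_gt0P; rewrite -(ltn_add2l #|[set i; j]|) cardsC card_ord addn0.
  by apply: leq_ltn_trans m3; rewrite cards2; case: (_ != _).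
by rewrite !inE negb_or => /andP[? ?]; exists k.
Qed.

Section Prism.
Variable m : nat.
Hypothesis m3 : 2 < m.
Let D := cartprod (complete m) (complete 2).

Lemma prismE i s j t : D (i, s) (j, t) = (i == j) && (s != t) || (s == t) && (i != j).
Proof. by []. Qed.

(** Two vertices in the same copy of K_m are distinguished by the neighbour of one in the other
    copy. Two in different copies are distinguished by a third vertex of one copy, which needs m >=
    3: for m = 2 the graph is C_4, which has twins. *)
Lemma prism_twin_free : twin_free D.
Proof.
move=> [i s] [j t] /twinsP H; have [st|st] := eqVneq s t.
  subst t; apply/eqP; rewrite xpair_eqE eqxx andbT; apply: contraT => ij.
  have [s' _ ss] : exists2 s' : 'I_2, true & s' != s.
    by exists (rev_ord s) => //; case: s {H} => [[|[|//]] ?].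
  have := H (i, s'); rewrite !xpair_eqE (negPf ss) !andbF !prismE.
  by rewrite eqxx (negPf ij) ss (negPf ss) => /(_ isT isT).
have [k ki kj] := ord_third i j m3.
have := H (k, s); rewrite !xpair_eqE (negPf ki) (negPf kj) => /(_ isT isT).
by rewrite !prismE eqxx (negPf ki) (negPf kj) (negPf st) andbF.
Qed.

Lemma prism_mixed i e : exists2 j, j != i & D i j != e.
Proof.
case: i => i s; have [k ki _] := ord_third i i m3.
have [s' _ ss] : exists2 s' : 'I_2, true & s' != s.
  by exists (rev_ord s) => //; case: s => [[|[|//]] ?].
case: e; last first.
  exists (k, s); first by rewrite xpair_eqE (negPf ki).
  by rewrite prismE eqxx [i == k]eq_sym ki orbT.
exists (k, s'); first by rewrite xpair_eqE (negPf ki).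
by rewrite prismE [i == k]eq_sym (negPf ki) [s == s']eq_sym (negPf ss).
Qed.

Lemma prism_supp4 : exists2 x, x \in gaut D & #|supp x| = 4.
Proof.
pose o : 'I_m := Ordinal (ltnW (ltnW m3)); pose l : 'I_m := Ordinal (ltnW m3).
have ol : o != l by [].
pose f (u : 'I_m * 'I_2) := (tperm o l u.1, u.2).
have fI : injective f by move=> [i s] [j t] [/perm_inj -> ->].
exists (perm fI).
  by apply/gautP=> -[i s] [j t]; rewrite !permE /f !prismE /= (inj_eq perm_inj).
have -> : supp (perm fI) = setX [set o; l] [set: 'I_2].
  apply/setP=> -[i s]; rewrite !inE permE /f xpair_eqE eqxx !andbT /=.
  by have := supp_tperm ol => /setP/(_ i); rewrite !inE.
by rewrite cardsX cards2 ol cardsT card_ord.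
Qed.

Lemma lex_prism_motion (W : finType) (Theta : graph W) : W ->
  motion (lexprod Theta D) = 4 /\ motion (lexprod Theta (complement D)) = 4.
Proof.
move=> w; have [x xD sx] := prism_supp4; split.
  exact: (lex_motion4 _ w prism_twin_free prism_mixed xD).
apply: (lex_motion4 _ w _ _ (complement_gaut xD) sx).
  exact: complement_twin_free prism_twin_free.
exact: complement_mixed prism_mixed.
Qed.

End Prism.

Lemma pair_partition_involution (W : finType) (P : pair_partition W) :
  exists pr : W -> W, [/\ involutive pr, forall w, pr w != w
    & forall w w', ([set w; w'] \in blocks P) = (w' == pr w)].
Proof.
have /and3P[/eqP covP tP _] := blocks_partition P.
have ex w : exists w', (w' != w) && ([set w; w'] \in blocks P).
  have : w \in cover P by rewrite covP inE.
  case/bigcupP=> B BP wB; have /eqP/cards2P[a [b [ab BE]]] := blocks_card2 BP.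
  move: wB; rewrite BE !inE => /orP[] /eqP ->.
    by exists b; rewrite eq_sym ab -BE.
  by exists a; rewrite ab setUC -BE.
pose pr w := xchoose (ex w).
have prn w : pr w != w by have /andP[] := xchooseP (ex w).
have prP w : [set w; pr w] \in blocks P by have /andP[] := xchooseP (ex w).
have prE w w' : ([set w; w'] \in blocks P) = (w' == pr w).
  apply/idP/eqP => [wP|->//].
  have E : [set w; w'] = [set w; pr w].
    by rewrite -(def_pblock tP wP (set21 _ _)) (def_pblock tP (prP w) (set21 _ _)).
  have ww : w' != w.
    by apply/eqP=> ww; have := blocks_card2 wP; rewrite ww cards2 eqxx.
  by have : w' \in [set w; pr w]; [rewrite -E set22 | rewrite !inE (negPf ww) => /eqP].
exists pr; split=> // w; apply/esym/eqP.
by rewrite -prE setUC.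
Qed.

(** * Twins and double transpositions of an inflation *)

Section InfMotion.
Variables (W : finType) (S : graph W) (P : pair_partition W).
Variables (m : nat) (lambda kappa : bool) (pr : W -> W).
Hypotheses (prK : involutive pr) (prn : forall w, pr w != w).
Hypothesis prE : forall w w', ([set w; w'] \in blocks P) = (w' == pr w).
Hypothesis m2 : 2 <= m.
Let I := Inf S P m lambda kappa.

Lemma InfE u i v j : I (u, i) (v, j) =
  if v == pr u then (i == j) == lambda
  else if v == u then (i != j) && kappa else S u v.
Proof.
rewrite /= /Inf_rel /= prE; have [->|vu] := eqVneq v (pr u).
  rewrite [u == _]eq_sym (negPf (prn u)) /= orbF.
  by case: (lambda) (i == j) => [] [].
have [->|uv] := eqVneq v u; first by rewrite edge_irr ?eqxx /= eqb_id.
by rewrite /= orbF.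
Qed.

Lemma ord_other (i : 'I_m) : exists j, j != i.
Proof.
have : 0 < #|[set~ i]| by rewrite cardsC1 card_ord; lia.
by case/card_gt0P=> j; rewrite !inE; exists j.
Qed.

(** Two indices are exchanged in both rows of one block. Edges within these rows depend only on
    equality of indices, and all edges leaving them ignore indices. *)
Lemma Inf_supp4 : W -> exists2 x, x \in gaut I & #|supp x| = 4.
Proof.
move=> a; pose o : 'I_m := Ordinal (ltnW m2); pose l : 'I_m := Ordinal m2.
have ol : o != l by [].
pose B := [set a; pr a].
pose f (u : W * 'I_m) := (u.1, if u.1 \in B then tperm o l u.2 else u.2).
have fI : injective f.
  by move=> [u i] [v j] [] /= <-; case: ifP => _ => [/perm_inj ->|->].
have Bpr u : (pr u \in B) = (u \in B).
  rewrite !inE (inj_eq (inv_inj prK)) orbC; congr (_ || _).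
  by rewrite -(inj_eq (inv_inj prK)) prK.
exists (perm fI).
  have fE u i : f (u, i) = (u, if u \in B then tperm o l i else i) by [].
  apply/gautP=> -[u i] [v j]; rewrite !permE !fE !InfE.
  have [->|vu] := eqVneq v (pr u); first by rewrite Bpr; case: ifP; rewrite ?(inj_eq perm_inj).
  by have [->|//] := eqVneq v u; case: ifP; rewrite ?(inj_eq perm_inj).
have -> : supp (perm fI) = setX B [set o; l].
  apply/setP=> -[u i]; rewrite in_setX inE permE /f xpair_eqE eqxx /=.
  have := supp_tperm ol => /setP/(_ i); rewrite inE => <-.
  by case: ifP => _; rewrite ?eqxx.
by rewrite cardsX !cards2 ol eq_sym prn.
Qed.

(** Vertices (u, i) and (u, j) are distinguished by (pr u, i). Twins over one block make the block
    transposition an automorphism, which forces [lambda] = [kappa] and m >= 3; a third index then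
    distinguishes them. Over different blocks, the row of pr u sees (v, j) uniformly but not (u,
    i). *)
Lemma Inf_twin_free : ~ (lambda <> kappa /\ has_block_transposition S P) ->
    ~ (m = 2 /\ lambda = kappa /\ has_block_transposition S P) ->
  twin_free I.
Proof.
move=> H1 H2 [u i] [v j] /twinsP H; have [vu|vu] := eqVneq v u.
  subst v; apply/eqP; rewrite xpair_eqE eqxx /=; apply: contraT => ij.
  have := H (pr u, i); rewrite !xpair_eqE (negPf (prn u)) => /(_ isT isT).
  by rewrite !InfE prK !eqxx (negPf ij); case: (lambda).
have [vpu|vpu] := eqVneq v (pr u).
  subst v.
  have hbt : has_block_transposition S P.
    exists u, (pr u); rewrite prE eqxx; split=> //; rewrite tperm_gaut.
    apply/twinsP=> w wu wpu; have := H (w, i); rewrite !xpair_eqE.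
    rewrite (negPf wu) (negPf wpu) => /(_ isT isT); rewrite !InfE.
    have upw : u != pr w by apply: contraNneq wpu => ->; rewrite prK.
    by rewrite (inj_eq (inv_inj prK)) !(eq_sym _ w) (negPf wu) (negPf wpu) (negPf upw).
  have lk : lambda = kappa.
    by apply/eqP; apply: contraT => lk; case: H1; split=> //; exact/eqP.
  have m3 : 2 < m.
    by rewrite ltn_neqAle m2 andbT; apply/eqP=> mE; case: H2; split.
  have [k ki kj] := ord_third i j m3.
  have := H (u, k); rewrite !xpair_eqE (negPf ki) (negPf kj) andbF => /(_ isT).
  rewrite andbF => /(_ isT); rewrite !InfE eqxx [u == _]eq_sym (negPf (prn u)) eqxx.
  by rewrite ki (negPf kj) lk; case: kappa.
have [k ki] := ord_other i.
have pu l : I (pr u, l) (v, j) = I (pr u, l) (u, i).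
  apply/esym/H; rewrite xpair_eqE negb_and ?(prn u) //.
  by rewrite eq_sym vpu.
have := pu i; have := pu k; rewrite !InfE prK eqxx (negPf vu) (negPf vpu) => -> /esym.
by rewrite eqxx (negPf ki); case: lambda.
Qed.

End InfMotion.

Lemma Inf_motion (W : finType) (S : graph W) (P : pair_partition W)
    (m : nat) (lambda kappa : bool) : W -> 2 <= m ->
    ~ (lambda <> kappa /\ has_block_transposition S P) ->
    ~ (m = 2 /\ lambda = kappa /\ has_block_transposition S P) ->
  motion (Inf S P m lambda kappa) = 4.
Proof.
move=> w m2 H1 H2; have [pr [prK prn prE]] := pair_partition_involution P.
have [x xI sx] := Inf_supp4 S lambda kappa prK prn prE m2 w.
exact: (supp4_motion (Inf_twin_free prK prn prE m2 H1 H2) xI sx).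
Qed.

Theorem theorem1p1 (n : nat) (V : finType) (G : graph V)
    (card_V : #|V| = n) (transG : vertex_transitive G) :
  (* part 1 *)
  [/\ (exists2 x, x \in gaut G & is_cycle 2 x) <-> motion G = 2,
      (exists2 x, x \in gaut G & is_cycle 2 x) -> lex_K_form n G
    & forall (W : finType) (Theta : graph W) (m : nat),
        vertex_transitive Theta -> 2 <= m ->
        motion (lexprod Theta (complete m)) = 2
        /\ motion (lexprod Theta (edgeless m)) = 2]
  /\
  (* part 2 *)
  (forall p : nat, prime p -> 3 <= p ->
     (exists2 x, x \in gaut G & is_cycle p x) ->
     ((motion G = 2 /\ lex_K_form n G)
      \/ (exists (S : graph 'Z_p) (W : finType) (Theta : graph W),
            [/\ circulant S, vertex_transitive Theta
              & graph_iso G (lexprod Theta S)]))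
     /\ (forall (S : graph 'Z_p) (W : finType) (Theta : graph W),
           circulant S -> vertex_transitive Theta ->
           graph_iso G (lexprod Theta S) ->
           (graph_iso S (complete p) \/ graph_iso S (edgeless p) ->
              motion G = 2)
           /\ (~ (graph_iso S (complete p) \/ graph_iso S (edgeless p)) ->
              motion G = p.-1)))
  /\
  (* part 3 *)
  [/\ motion G = 4 ->
      [\/ exists (W : finType) (Theta : graph W),
            vertex_transitive Theta /\ graph_iso G (lexprod Theta C5),
          exists (m : nat) (W : finType) (Theta : graph W),
            [/\ 3 <= m, vertex_transitive Theta
              & graph_iso G (lexprod Theta (cartprod (complete m) (complete 2)))
                \/ graph_iso G
                     (lexprod Theta
                        (complement (cartprod (complete m) (complete 2))))]
        | exists (m : nat) (lambda kappa : bool) (W : finType)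
                 (S : graph W) (P : pair_partition W),
            [/\ 2 <= m,
                [transitive gaut_part S P, on [set: W] | 'P],
                ~ (lambda <> kappa /\ has_block_transposition S P)
              & graph_iso G (Inf S P m lambda kappa)]],
      forall (W : finType) (Theta : graph W) (m : nat),
        vertex_transitive Theta -> 3 <= m ->
        [/\ motion (lexprod Theta C5) = 4,
            motion (lexprod Theta (cartprod (complete m) (complete 2))) = 4
          & motion (lexprod Theta
                      (complement (cartprod (complete m) (complete 2)))) = 4]
    & forall (W : finType) (S : graph W) (P : pair_partition W)
             (m : nat) (lambda kappa : bool),
        vertex_transitive S -> invariant_partition S P -> 2 <= m ->
        ~ (lambda <> kappa /\ has_block_transposition S P) ->
        (* fails without this exclusion: see [motion_Inf_K2] *)
        ~ (m = 2 /\ lambda = kappa /\ has_block_transposition S P) ->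
        motion (Inf S P m lambda kappa) = 4].
Proof.
split; [split | split; last split].
- exact: motion2_is_cycle.
- by move/motion2_is_cycle; rewrite -card_V; exact: twins_lex_K_form.
- move=> W Theta m /imsetP[w _ _] m2; split.
    by apply: (@uniform_lex_motion _ _ _ _ true) => //; rewrite card_ord.
  by apply: (@uniform_lex_motion _ _ _ _ false) => //; rewrite card_ord.
- move=> p p_prime p3 [x xG cx]; split.
    have [m2|/eqP m2] := eqVneq (motion G) 2.
      by left; split=> //; rewrite -card_V; exact: twins_lex_K_form.
    have [S [W [Theta [cS _ tT iT]]]] :=
      cycle_lex p_prime transG (motion_neq2 m2) xG cx.
    by right; exists S, W, Theta.
  move=> S W Theta cS /imsetP[w _ _] /motion_iso ->; split.
    move/iso_uniform=> [e eU]; apply: (uniform_lex_motion Theta w _ eU).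
    by rewrite card_Zp_prime // ltnW.
  move=> nS; apply: lex_circulant_motion => // -[e eU]; case: nS.
  have := uniform_iso (card_Zp_prime p_prime) eU.
  by case: e {eU} => ?; [left | right].
- exact: motion4_forms.
- move=> W Theta m /imsetP[w _ _] m3.
  have [? ?] := lex_prism_motion m3 Theta w; split=> //.
  exact: (lex_circulant_motion Theta (isT : prime 5) isT C5_circulant C5_not_uniform w).
move=> W S P m lambda kappa /imsetP[w _ _] _; exact: Inf_motion.
Qed.
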